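(* Consider the directed Chung--Lu model with adjacency matrix $A_n$. If the rank-one weight profile assumption (W) and the growth assumption (X) (stated in the context) hold, then there exist $K>0$ and $\eta>1$ such that, for all sufficiently large $n$, $$\mathbb{P}\left(\max\left\{|\lambda_1(A_n)-\lambda_1(\mathbb{E}[A_n])|,\ \max_{2\le j\le n}|\lambda_j(A_n)|\right\}\ge K\sqrt{s_n}\right)\le e^{-(\log n)^{\eta}}.$$
   Context: Model. For every $n$ let $(w_x^+,w_x^-)_{x\in[n]}$ be deterministic non-negative weights (depending on $n$) with $\sum_{x=1}^n w_x^+=\sum_{x=1}^n w_x^-=:\mathbf{w}_n$. The matrix $A_n=(a_{xy})_{x,y\in[n]}$ has independent Bernoulli entries with $p_{xy}:=\mathbb{P}(a_{xy}=1)=s_n w_x^+w_y^-/\mathbf{w}_n$, where $s_n>0$; under the assumptions below $p_{xy}<1$ for large $n$. (W) There exist constants $0<c<C<\infty$ with $c\le w_x^\pm\le C$ for all $x\in[n]$, $n\ge1$; moreover there is a compactly supported probability measure $\rho$ on $(0,\infty)^2$ such that $\frac1n\sum_{x=1}^n\delta_{\sqrt{n/\mathbf{w}_n}\,(w_x^+,w_x^-)}$ converges weakly to $\rho$. (X) There exists $\xi>4$ such that $\log^\xi(n)\ll s_n\ll n$, where $a_n\ll b_n$ means $a_n/b_n\to0$. Eigenvalues of an $n\times n$ complex matrix $M$ are ordered so that $|\lambda_1(M)|\ge|\lambda_2(M)|\ge\dots\ge|\lambda_n(M)|$. *)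

(* Defs.v *)
From HB Require Import structures.
From mathcomp Require Import all_boot all_order all_algebra.
From mathcomp Require Import all_classical all_reals all_analysis.
From mathcomp Require Import complex.
Set Implicit Arguments.
Unset Strict Implicit.
Unset Printing Implicit Defensive.
Import Order.TTheory GRing.Theory Num.Theory.
Import numFieldNormedType.Exports.
Export numFieldNormedType.Exports.
Local Open Scope classical_set_scope.
Local Open Scope ring_scope.
Local Open Scope complex_scope.

Definition cmod (R : realType) (z : R[i]) : R := ComplexField.Normc.normc z.

(* Eigenvalues are repeated according to algebraic multiplicity.  Ties in
   modulus are broken arbitrarily, so several [t] may qualify for one [M]. *)
Definition ordered_spectrum (R : realType) (n : nat) (M : 'M[R[i]]_n)
    (t : n.-tuple R[i]) : Prop :=
  char_poly M = \prod_(z <- t) ('X - z%:P) /\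
  (forall i j : 'I_n, (i <= j)%N -> cmod (tnth t j) <= cmod (tnth t i)).

Lemma ordered_spectrum_exists (R : realType) (n : nat) (M : 'M[R[i]]_n) :
  exists t : n.-tuple R[i], ordered_spectrum M t.
Proof.
have [r Hr] := closed_field_poly_normal (char_poly M).
move: Hr; rewrite (monicP (char_poly_monic M)) scale1r => Hr.
have szr : size r = n.
  by have := size_char_poly M; rewrite Hr size_prod_XsubC => -[].
pose e := fun z w : R[i] => cmod w <= cmod z.
have e_tot : total e by move=> z w; exact: le_total.
have e_tr : transitive e by move=> y x z xy yz; exact: le_trans yz xy.
have szs : size (sort e r) == n by rewrite size_sort szr.
exists (Tuple szs); split.
  rewrite Hr; apply: perm_big; rewrite perm_sym; exact/permPl/perm_sort.
move=> i j ij; rewrite !(tnth_nth 0) /=.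
apply: (@sorted_leq_nth _ e e_tr _ 0 (sort e r)) => //.
- by move=> x; exact: lexx.
- exact: sort_sorted.
- by rewrite inE (eqP szs).
- by rewrite inE (eqP szs).
Qed.

(* Numbered from 1, as in |lambda_1| >= ... >= |lambda_n|; the value 0 outside
   1 <= j <= n is junk. *)
Definition eigval (R : realType) (n : nat) (t : n.-tuple R[i]) (j : nat) : R[i] :=
  nth 0 t j.-1.

(* The product rule over every finite subfamily of a finite family of random
   variables. *)
Definition mutually_independent (R : realType) (d d' : measure_display)
    (T : measurableType d) (U : measurableType d') (P : probability T R)
    (I : finType) (X : I -> {RV P >-> U}) : Prop :=
  forall (J : {set I}) (B : I -> set U), (forall i, measurable (B i)) ->
    P [set t | forall i, i \in J -> B i (X i t)]
    = (\prod_(i in J) P [set t | B i (X i t)])%E.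

Definition total_weight (R : realType) (n : nat) (w : 'I_n -> R) : R :=
  \sum_x w x.

Definition link_prob (R : realType) (n : nat) (wp wm : 'I_n -> R) (s : R)
    (x y : 'I_n) : R :=
  s * wp x * wm y / total_weight wp.

Definition directed_chung_lu (R : realType) (n : nat) (wp wm : 'I_n -> R) (s : R)
    (d : measure_display) (T : measurableType d) (P : probability T R)
    (a : 'I_n -> 'I_n -> {RV P >-> bool}) : Prop :=
  (forall x y, P [set t | a x y t = true] = (link_prob wp wm s x y)%:E) /\
  mutually_independent (fun e : 'I_n * 'I_n => a e.1 e.2).

Definition adjacency (R : realType) (n : nat) (d : measure_display)
    (T : measurableType d) (P : probability T R)
    (a : 'I_n -> 'I_n -> {RV P >-> bool}) (t : T) : 'M[R]_n :=
  \matrix_(x, y) (a x y t)%:R.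

Definition mean_matrix (R : realType) (n : nat) (d : measure_display)
    (T : measurableType d) (P : probability T R) (A : T -> 'M[R]_n) : 'M[R]_n :=
  \matrix_(x, y) fine ('E_P[fun t => A t x y])%E.

Definition to_complex (R : realType) (n : nat) (M : 'M[R]_n) : 'M[R[i]]_n :=
  map_mx (real_complex R) M.

Definition empirical_measure (R : realType) (r : seq (R * R)) :
    {measure set (R * R) -> \bar R} :=
  mscale (((size r)%:R : R)^-1)%:nng
    (msum (fun k => dirac (nth (0, 0) r k)) (size r)).

Definition weakly_converges (R : realType)
    (mu : nat -> {measure set (R * R) -> \bar R})
    (nu : {measure set (R * R) -> \bar R}) : Prop :=
  forall f : R * R -> R, continuous f -> (exists M, forall z, `|f z| <= M) ->
    (\int[mu n]_z (f z)%:E @[n --> \oo] --> \int[nu]_z (f z)%:E)%E.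

(* A probability measure on (0,oo)^2 with compact support is encoded as one on
   R^2 concentrated on a compact subset of the open quadrant. *)
Definition compactly_supported_in_quadrant (R : realType)
    (rho : probability (R * R)%type R) : Prop :=
  exists K : set (R * R),
    [/\ compact K, K `<=` [set z | 0 < z.1 /\ 0 < z.2] & rho (~` K) = 0%E].

Definition rescaled_weights (R : realType) (n : nat) (wp wm : 'I_n -> R) :
    seq (R * R) :=
  [seq (Num.sqrt (n%:R / total_weight wp) * wp x,
        Num.sqrt (n%:R / total_weight wp) * wm x) | x <- enum 'I_n].

Definition assumption_W (R : realType) (wp wm : forall n, 'I_n -> R) : Prop :=
  (exists c C : R, [/\ 0 < c, c < C &
     forall n (x : 'I_n), c <= wp n x <= C /\ c <= wm n x <= C]) /\
  (exists rho : probability (R * R)%type R,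
     compactly_supported_in_quadrant rho /\
     weakly_converges
       (fun n => empirical_measure (rescaled_weights (@wp n) (@wm n))) rho).

Definition much_less (R : realType) (a b : nat -> R) : Prop :=
  a n / b n @[n --> \oo] --> (0 : R).

Definition assumption_X (R : realType) (s : nat -> R) : Prop :=
  exists xi : R, [/\ 4 < xi,
    much_less (fun n => ln n%:R `^ xi) s & much_less s (fun n => n%:R)].

(* Main.v *)
(* Split [A_n] into its rank-one mean [E A_n] and the noise [H].

   The noise is controlled by the trace method.  Expanding [E tr (H H^T)^k] over
   closed walks, only walks using no edge exactly once contribute, and a walk with
   [v] vertices and [e >= v - 1] edges contributes at most [q^e], [q = O(s/n)].
   Grouping walks by their vertex pattern shows that this is at most [n/k] times
   the same expectation for a [2k x 2k] matrix of independent dice with values 2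
   (probability 1/3) and -1 (probability 2/3), whose moments vanish in order 1 and
   are at least 1 from order 2 on, as soon as [n q <= k].  The norm of this small
   matrix is [O(sqrt k)] by a net argument.  With [k] of order [s] this yields
   [|H| = O(sqrt s)] outside an event of probability at most [n exp (- s)].

   Given the norm bound, every eigenvalue of modulus above [K sqrt s] lies within
   [K sqrt s] of [lambda_1 (E A_n)]; there is one by the intermediate value theorem
   for the characteristic polynomial on the real axis, and there are not two of
   them because a 2 x 2 minor of a rank-one matrix vanishes. *)
Require Import Defs.
From mathcomp Require Import all_boot all_order all_fingroup all_algebra.
From mathcomp Require Import all_classical all_reals all_analysis.
From mathcomp Require Import complex spectral mxred.
From mathcomp Require Import zify ring lra.
Import Order.TTheory GRing.Theory Num.Theory.
Set Implicit Arguments.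
Unset Strict Implicit.
Unset Printing Implicit Defensive.
Local Open Scope ring_scope.

(** * Vertex patterns and closed walks *)

(** A net argument applied directly to the noise would lose: its entries have variance of order s/n
    but size up to 1, so they are not sub-Gaussian at their own scale. The walk expansion only sees
    which edges coincide, which permits a comparison with a small matrix whose entries have order 1;
    there a net argument is sharp up to constants, and no enumeration of walks is needed. The
    comparison requires moments bounded below by 1 in every order from 2 on, odd orders included.
    Symmetric signs fail this at order 3, hence the skewed die.

    The trace exponent is a power of 2 because a norm bound is extracted from a trace by repeated
    squaring, without diagonalisation. The exponent 138 in the final norm bound exceeds by 2 the 136
    of the dice estimate; the gain exp (- 2 k) pays for a factor 2 and for the tail exp (- k). *)

Lemma undup_map_in (T U : eqType) (f : T -> U) (s : seq T) :
  {in s &, injective f} -> undup (map f s) = map f (undup s).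
Proof.
elim: s => //= x s IHs f_inj.
have f_inj_s : {in s &, injective f}.
  by move=> y z ys zs; apply: f_inj; rewrite inE ?ys ?zs orbT.
rewrite IHs //.
have -> : (f x \in map f s) = (x \in s).
  apply/mapP/idP => [[y ys fxy]|xs]; last by exists x.
  by rewrite (f_inj _ _ _ _ fxy) // inE ?eqxx ?ys ?orbT.
by case: ifP.
Qed.

Lemma count_mem_map_in (T U : eqType) (f : T -> U) (s : seq T) (x : T) :
  {in s &, injective f} -> x \in s -> count_mem (f x) (map f s) = count_mem x s.
Proof.
move=> f_inj xs; rewrite count_map; apply: eq_in_count => y ys /=.
by apply/eqP/eqP => [|->//]; apply: f_inj.
Qed.

Lemma index_in_inj (T : eqType) (s : seq T) :
  {in s &, injective (fun x => index x s)}.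
Proof. by move=> x y xs ys eq_xy; rewrite -(nth_index x xs) eq_xy nth_index. Qed.

(** Canonical form of a sequence up to injective renaming of its entries. Labels follow the order of
    last occurrences, since [undup] keeps the last copy of each entry. *)
Definition pattern (T : eqType) (s : seq T) : seq nat :=
  [seq index x (undup s) | x <- s].

Lemma pattern_inj_in (T : eqType) (s : seq T) :
  {in s &, injective (fun x => index x (undup s))}.
Proof. by move=> x y xs ys; apply: index_in_inj; rewrite mem_undup. Qed.

Lemma size_undup_pattern (T : eqType) (s : seq T) :
  size (undup (pattern s)) = size (undup s).
Proof. by rewrite undup_map_in ?size_map //; apply: pattern_inj_in. Qed.

Lemma undup_pattern (T : eqType) (s : seq T) :
  undup (pattern s) = iota 0 (size (undup s)).
Proof.
rewrite undup_map_in; last exact: pattern_inj_in.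
case: s => [//|x0 s0]; set s := x0 :: s0.
apply: (@eq_from_nth _ 0%N); first by rewrite size_map size_iota.
move=> i; rewrite size_map => i_lt.
by rewrite (nth_map x0) // nth_iota // index_uniq // undup_uniq.
Qed.

Lemma pattern_map (T U : eqType) (f : T -> U) (s : seq T) :
  {in s &, injective f} -> pattern (map f s) = pattern s.
Proof.
move=> f_inj; rewrite /pattern undup_map_in // -map_comp.
apply/eq_in_map => x xs /=.
have x_in : x \in undup s by rewrite mem_undup.
have : {subset undup s <= s} by move=> y; rewrite mem_undup.
elim: (undup s) x_in => //= y r IHr; rewrite inE => x_in sub.
have ys : y \in s by apply: sub; rewrite inE eqxx.
have [->|ne_yx] := eqVneq y x; first by rewrite eqxx.
case: eqP => [/(f_inj _ _ ys xs) e|_]; first by rewrite e eqxx in ne_yx.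
congr _.+1; apply: IHr; first by rewrite eq_sym (negbTE ne_yx) in x_in.
by move=> z zr; apply: sub; rewrite inE zr orbT.
Qed.

Lemma pattern_id (T : eqType) (s : seq T) : pattern (pattern s) = pattern s.
Proof. by apply: pattern_map; apply: pattern_inj_in. Qed.

Lemma pattern_lt (T : eqType) (s : seq T) : all (gtn (size s)) (pattern s).
Proof.
apply/allP => i /mapP[x xs ->] /=.
by rewrite (@leq_trans (size (undup s))) ?size_undup // index_mem mem_undup.
Qed.

(** A tuple of pattern [p] amounts to its list [undup t] of distinct entries, which can be any
    injective choice of the required length. *)
Lemma card_pattern (n k : nat) (p : seq nat) : size p = k -> pattern p = p ->
  #|[set t : k.-tuple 'I_n | pattern t == p]| = (n ^_ (size (undup p)))%N.
Proof.
move=> size_p pat_p; set v := size (undup p).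
have undup_p : undup p = iota 0 v by rewrite -[in LHS]pat_p undup_pattern.
(* The main argument reads entries with the default [ord0], so an empty vertex set is treated
   apart. *)
have [n0|n_gt0] := posnP n.
  rewrite n0 ffact0n; case: k size_p => [/size0nil p0|k size_p].
    rewrite /v p0 (_ : [set _ | _] = [set [tuple]]) ?cards1 //.
    by apply/setP => t; rewrite !inE (tuple0 t) eqxx.
  have -> : (v == 0%N) = false.
    rewrite /v; case: p size_p {pat_p v undup_p} => //= a p _.
    by case: ifP => // ap; move: ap; rewrite -mem_undup; case: undup.
  by apply: eq_card0 => t; case: (thead t).
case: n n_gt0 => // n _.
rewrite -[in RHS](card_ord n.+1) -card_uniq_tuples.
pose f (u : v.-tuple 'I_n.+1) : k.-tuple 'I_n.+1 :=
  [tuple nth ord0 u (nth 0%N p i) | i < k].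
have fE u : f u = map (nth ord0 u) p :> seq _.
  apply: (@eq_from_nth _ ord0); first by rewrite size_tuple size_map size_p.
  move=> i; rewrite size_tuple => i_lt.
  rewrite (nth_map 0%N) ?size_p //.
  by rewrite -[LHS](tnth_nth _ _ (Ordinal i_lt)) tnth_mktuple.
have p_lt i : i \in p -> (i < v)%N by rewrite -mem_undup undup_p mem_iota.
have f_inj (u : v.-tuple 'I_n.+1) : uniq u -> {in p &, injective (nth ord0 u)}.
  move=> uniq_u i j /p_lt i_lt /p_lt j_lt /eqP.
  by rewrite nth_uniq ?size_tuple // => /eqP.
have undup_f (u : v.-tuple 'I_n.+1) : uniq u -> undup (f u) = u.
  move=> uniq_u; rewrite fE undup_map_in; last exact: f_inj.
  by rewrite undup_p -[RHS](mkseq_nth ord0) /mkseq size_tuple.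
rewrite -(@card_in_imset _ _ f); last first.
  move=> u1 u2; rewrite !inE => /andP[_ U1] /andP[_ U2] e.
  by apply: val_inj; rewrite /= -(undup_f _ U1) -(undup_f _ U2) e.
apply: eq_card => t; rewrite !inE; apply/eqP/imsetP => [pat_t|[u]].
  have size_ut : size (undup t) == v by rewrite -size_undup_pattern pat_t.
  exists (Tuple size_ut).
    by rewrite inE /= undup_uniq andbT; apply/allP.
  apply: val_inj; rewrite [RHS]fE /= -pat_t -map_comp -[LHS]map_id.
  by apply/eq_in_map => x xt /=; rewrite nth_index // mem_undup.
rewrite inE => /andP[_ uniq_u] ->.
rewrite /pattern undup_f // fE -map_comp -[RHS]map_id.
apply/eq_in_map => i /p_lt i_lt /=.
by rewrite index_uniq // size_tuple.
Qed.

(** The index set on the right, the fixed points of [pattern] with labels below [k], does not depend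
    on [n]: sums in two different dimensions can then be compared term by term. *)
Lemma sum_pattern (R : pzRingType) (n k : nat) (F : seq nat -> R) :
  \sum_(t : k.-tuple 'I_n) F (pattern t) =
  \sum_(p : k.-tuple 'I_k | pattern p == map val p)
    (n ^_ (size (undup (map val p))))%:R * F (map val p).
Proof.
have tuple_pattern (t : k.-tuple 'I_n) :
    exists p : k.-tuple 'I_k, map val p = pattern t.
  have := pattern_lt t; rewrite size_tuple.
  case: k t => [|k] t; first by exists [tuple]; rewrite (tuple0 t).
  move=> /allP t_lt; have s_p : size (map (@inord k) (pattern t)) == k.+1.
    by rewrite !size_map size_tuple.
  exists (Tuple s_p); rewrite /= -map_comp -[RHS]map_id.
  by apply/eq_in_map => i /t_lt /= i_lt; rewrite inordK.
transitivity (\sum_(t : k.-tuple 'I_n)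
    \sum_(p : k.-tuple 'I_k | map val p == pattern t) F (map val p)).
  apply: eq_bigr => t _; have [p pE] := tuple_pattern t.
  rewrite (big_pred1 p) ?pE // => p' /=; rewrite -pE.
  by apply/eqP/eqP => [/(inj_map val_inj) /val_inj //|->].
rewrite (exchange_big_dep (fun p : k.-tuple 'I_k => pattern p == map val p)).
  apply: eq_bigr => p /eqP pat_p; rewrite -(@card_pattern n k); first last.
  - by rewrite -pat_p pattern_id.
  - by rewrite size_map size_tuple.
  rewrite -sum1_card natr_sum mulr_suml; apply: eq_big => t.
    by rewrite inE eq_sym.
  by rewrite mul1r.
by move=> t p _ /= /eqP pE; rewrite -(pattern_map (f := val)) ?pE ?pattern_id //;
  move=> x y _ _; apply: val_inj.
Qed.

(** * Closed walks and the trace expansion *)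

Lemma size_undup_cons (T : eqType) (x : T) (s : seq T) :
  size (undup (x :: s)) = ((x \notin s) + size (undup s))%N.
Proof. by rewrite /=; case: (x \in s). Qed.

Lemma size_undup_eq_mem (T : eqType) (s1 s2 : seq T) :
  s1 =i s2 -> size (undup s1) = size (undup s2).
Proof.
move=> eq_s; apply/perm_size/uniq_perm; rewrite ?undup_uniq //.
by move=> x; rewrite !mem_undup.
Qed.

Lemma big_tuple_cons (R : nmodType) (T : finType) (k : nat) (F : seq T -> R) :
  \sum_(t : k.+1.-tuple T) F t = \sum_x \sum_(t : k.-tuple T) F (x :: t).
Proof.
rewrite pair_big /= (reindex (fun p : T * k.-tuple T => [tuple of p.1 :: p.2])) //=.
exists (fun t : k.+1.-tuple T => (thead t, [tuple of behead t])) => [[x t] _|t _] /=.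
  by congr (_, _); apply: val_inj.
by rewrite [RHS]tuple_eta.
Qed.

Lemma big_tuple0 (R : nmodType) (T : finType) (F : 0.-tuple T -> R) :
  \sum_t F t = F [tuple].
Proof. by apply: big_pred1 => t; apply/esym/eqP; apply: tuple0. Qed.

(** Edges of the bipartite walk x, r_0, l_0, r_1, ..., z. Rows and columns form two separate vertex
    sets because the matrix is not symmetric. The edges are not listed in order of traversal; only
    their multiset matters. *)
Definition walk (T U : Type) (x : T) (l : seq T) (r : seq U) (z : T) : seq (T * U) :=
  zip (x :: l) r ++ zip (rcons l z) r.

(* The closed walk visits l_0, r_0, l_1, r_1, ..., and returns to l_0. *)
Definition closed_walk (T U : Type) (l : seq T) (r : seq U) : seq (T * U) :=
  zip l r ++ zip (rot 1 l) r.

Lemma closed_walk_cons (T U : Type) (x : T) (l : seq T) (r : seq U) :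
  closed_walk (x :: l) r = walk x l r x.
Proof. by rewrite /closed_walk rot1_cons. Qed.

Lemma perm_walk_cons (T U : eqType) (x z x1 : T) (l : seq T) (y : U) (r : seq U) :
  perm_eq (walk x (x1 :: l) (y :: r) z) ((x, y) :: (x1, y) :: walk x1 l r z).
Proof.
rewrite /walk /= perm_cons -[(x1, y) :: zip _ r]cat1s perm_catCA /=.
by rewrite perm_cons.
Qed.

Lemma walk_entry (R : comPzRingType) (n k : nat) (H : 'M[R]_n) (x z : 'I_n) :
  ((H *m H^T) ^+ k.+1) x z =
  \sum_(l : k.-tuple 'I_n) \sum_(r : k.+1.-tuple 'I_n)
     \prod_(e <- walk x l r z) H e.1 e.2.
Proof.
elim: k x => [|k IHk] x.
  rewrite expr1 mxE big_tuple0.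
  rewrite (big_tuple_cons _ (fun r => \prod_(e <- walk x [::] r z) H e.1 e.2)).
  apply: eq_bigr => y _.
  rewrite big_tuple0.
  by rewrite /walk /= !big_cons big_nil mulr1 mxE.
rewrite exprS mxE.
rewrite (big_tuple_cons _ (fun l => \sum_(r : k.+2.-tuple 'I_n)
     \prod_(e <- walk x l r z) H e.1 e.2)).
apply: eq_bigr => x1 _; rewrite IHk mxE mulr_sumr; apply: eq_bigr => l _.
rewrite (big_tuple_cons _ (fun r => \prod_(e <- walk x (x1 :: l) r z) H e.1 e.2)).
rewrite mulr_suml; apply: eq_bigr => y _; rewrite mulr_sumr.
apply: eq_bigr => r _; rewrite (perm_big _ (perm_walk_cons x z x1 l y r)).
by rewrite !big_cons /= !mxE mulrA.
Qed.

Lemma trace_closed_walk (R : comPzRingType) (n k : nat) (H : 'M[R]_n) :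
  \tr ((H *m H^T) ^+ k.+1) =
  \sum_(l : k.+1.-tuple 'I_n) \sum_(r : k.+1.-tuple 'I_n)
     \prod_(e <- closed_walk l r) H e.1 e.2.
Proof.
rewrite (big_tuple_cons _ (fun l => \sum_(r : k.+1.-tuple 'I_n)
  \prod_(e <- closed_walk l r) H e.1 e.2)).
apply: eq_bigr => x _; rewrite walk_entry; apply: eq_bigr => l _.
by apply: eq_bigr => r _; rewrite closed_walk_cons.
Qed.

Lemma mem_walk (T U : eqType) (x z a : T) (l : seq T) (r : seq U) (b : U) :
  size r = (size l).+1 -> (a, b) \in walk x l r z ->
  (a \in x :: rcons l z) /\ (b \in r).
Proof.
move=> size_r; rewrite mem_cat => /orP[] /[dup] ab.
  move=> /(map_f fst) /=; rewrite -/(unzip1 _) unzip1_zip ?size_r // => a_in.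
  move: ab => /(map_f snd) /=; rewrite -/(unzip2 _) unzip2_zip ?size_r // => ->.
  by split=> //; move: a_in; rewrite !inE mem_rcons inE => /orP[->//|->]; rewrite !orbT.
move=> /(map_f fst) /=; rewrite -/(unzip1 _) unzip1_zip ?size_rcons ?size_r // => a_in.
move: ab => /(map_f snd) /=; rewrite -/(unzip2 _) unzip2_zip ?size_rcons ?size_r // => ->.
by rewrite inE a_in orbT.
Qed.

(* Walking backwards from the end, each new vertex is reached by a new edge. *)
Lemma size_undup_walk (T U : eqType) (x z : T) (l : seq T) (r : seq U) :
  size r = (size l).+1 ->
  (size (undup (x :: rcons l z)) + size (undup r) <= (size (undup (walk x l r z))).+1)%N.
Proof.
elim: l x r => [|x1 l IHl] x [|y r] //= [] size_r.
  case: r size_r => // _; rewrite /walk /= !inE.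
  have [->|ne_xz] := eqVneq x z; first by rewrite eqxx.
  by rewrite xpair_eqE (negbTE ne_xz).
rewrite -/(undup (x1 :: rcons l z)).
have -> : (if x \in x1 :: rcons l z then undup (x1 :: rcons l z)
  else x :: undup (x1 :: rcons l z)) = undup (x :: x1 :: rcons l z) by [].
rewrite (size_undup_eq_mem (perm_mem (perm_walk_cons x z x1 l y r))).
have -> : (if y \in r then undup r else y :: undup r) = undup (y :: r) by [].
rewrite 5!size_undup_cons.
have := IHl x1 r size_r; rewrite size_undup_cons.
set wk := walk x1 l r z; set u := size (undup (rcons l z)) => IH.
have memw a b : (a, b) \in wk -> (a \in x1 :: rcons l z) /\ (b \in r) by exact: mem_walk.
(* A new left vertex [x] makes [(x, y)] new, and a new right vertex [y] makes [(x1, y)] new, so each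
   added vertex is paid for by its own edge. *)
have e1 : ((x \notin x1 :: rcons l z) <= ((x, y) \notin (x1, y) :: wk))%N.
  case: (boolP (x \in _)) => //= x_notin.
  rewrite inE negb_or xpair_eqE eqxx andbT.
  have -> : x != x1 by apply: contra x_notin => /eqP->; rewrite inE eqxx.
  by case: (boolP (_ \in wk)) => //= /memw[] x_in; rewrite x_in in x_notin.
have e2 : ((y \notin r) <= ((x1, y) \notin wk))%N.
  case: (boolP (y \in r)) => //= y_notin.
  by case: (boolP (_ \in wk)) => //= /memw[] _ y_in; rewrite y_in in y_notin.
move: IH e1 e2; do 4!case: (_ \notin _) => /=; clear; lia.
Qed.

(** The edges of a walk form a connected graph, for which v <= e + 1. Closing the walk repeats the
    start vertex and so adds no vertex. *)
Lemma size_undup_closed_walk (T U : eqType) (l : seq T) (r : seq U) :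
  size l = size r ->
  (size (undup l) + size (undup r) <= (size (undup (closed_walk l r))).+1)%N.
Proof.
case: l => [|x l] size_r; first by case: r size_r.
rewrite closed_walk_cons; apply: leq_trans (size_undup_walk _ _ (esym size_r)).
rewrite leq_add2r; apply: eq_leq; apply: size_undup_eq_mem => a.
by rewrite !inE mem_rcons inE; case: eqP.
Qed.

Lemma closed_walk_map (T U T' U' : Type) (f : T -> T') (g : U -> U')
    (l : seq T) (r : seq U) :
  closed_walk (map f l) (map g r) =
  map (fun e => (f e.1, g e.2)) (closed_walk l r).
Proof.
have zip_mapfg (s : seq T) (t : seq U) : zip (map f s) (map g t) =
    map (fun e => (f e.1, g e.2)) (zip s t).
  by elim: s t => [|a s IHs] [|b t] //=; rewrite IHs.
by rewrite /closed_walk -map_rot !zip_mapfg map_cat.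
Qed.

Lemma mem_zip (T U : eqType) (l : seq T) (r : seq U) (e : T * U) :
  e \in zip l r -> e.1 \in l /\ e.2 \in r.
Proof.
elim: l r => [|a l IHl] [|b r] //=; rewrite !inE => /orP[/eqP->|/IHl[-> ->]] /=.
  by rewrite !eqxx.
by rewrite !orbT.
Qed.

Lemma mem_closed_walk (T U : eqType) (l : seq T) (r : seq U) (e : T * U) :
  e \in closed_walk l r -> e.1 \in l /\ e.2 \in r.
Proof.
by rewrite mem_cat => /orP[] /mem_zip; rewrite ?mem_rot.
Qed.

(** * Walk weights and their comparison across dimensions *)

Definition no_single (T : eqType) (s : seq T) : bool :=
  all (fun x => count_mem x s != 1)%N s.

Lemma no_single_map_in (T U : eqType) (f : T -> U) (s : seq T) :
  {in s &, injective f} -> no_single (map f s) = no_single s.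
Proof.
move=> f_inj; rewrite /no_single all_map; apply: eq_in_all => x xs /=.
by rewrite count_mem_map_in.
Qed.

(** With [q] of order s/n this bounds from above the expected product of noise entries along the
    walk; with [q = 1] it bounds from below the same quantity for the dice. *)
Definition walk_weight (R : pzRingType) (T U : eqType) (q : R)
    (l : seq T) (r : seq U) : R :=
  (no_single (closed_walk l r))%:R * q ^+ size (undup (closed_walk l r)).

Lemma walk_weight_pattern (R : pzRingType) (T U : eqType) (q : R)
    (l : seq T) (r : seq U) :
  walk_weight q (pattern l) (pattern r) = walk_weight q l r.
Proof.
have inj : {in closed_walk l r &, injective
    (fun e => (index e.1 (undup l), index e.2 (undup r)))}.
  move=> [a b] [a' b'] /mem_closed_walk[/= al br] /mem_closed_walk[/= al' br'] [] ea eb.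
  by congr (_, _); [apply: pattern_inj_in ea|apply: pattern_inj_in eb].
rewrite /walk_weight closed_walk_map no_single_map_in // undup_map_in //.
by rewrite size_map.
Qed.

Lemma sum_walk_weight (R : pzRingType) (n k : nat) (q : R) :
  \sum_(l : k.-tuple 'I_n) \sum_(r : k.-tuple 'I_n) walk_weight q l r =
  \sum_(p : k.-tuple 'I_k | pattern p == map val p)
  \sum_(p' : k.-tuple 'I_k | pattern p' == map val p')
    (n ^_ (size (undup (map val p))))%:R * (n ^_ (size (undup (map val p'))))%:R
      * walk_weight q (map val p) (map val p').
Proof.
under eq_bigr => l _ do under eq_bigr => r _ do rewrite -walk_weight_pattern.
under eq_bigr => l _ do rewrite (sum_pattern n _ (walk_weight q (pattern l))).
rewrite exchange_big /= [RHS]exchange_big /=; apply: eq_bigr => p' _.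
rewrite -mulr_sumr (sum_pattern n _ (fun s => walk_weight q s _)) mulr_sumr.
by apply: eq_bigr => p _; rewrite mulrA -!natrM; congr (_%:R * _); apply: mulnC.
Qed.

(** This is why the small matrix has dimension [d + k] and not [d]: the loss from distinctness of at
    most [k] vertices is compensated. *)
Lemma expn_leq_ffact (d k v : nat) : (v <= k -> d ^ v <= (d + k) ^_ v)%N.
Proof.
elim: v => [//|v IHv] v_lt; rewrite expnSr ffactnSr leq_mul ?IHv ?(ltnW v_lt) //.
by rewrite -addnBA ?(ltnW v_lt) // leq_addr.
Qed.

Lemma ffact_leq_expn (n v : nat) : (n ^_ v <= n ^ v)%N.
Proof.
by elim: v => [//|v IHv]; rewrite expnSr ffactnSr leq_mul // leq_subr.
Qed.

(** Pattern by pattern, with v vertices in all and e >= v - 1 edges: n^v q^e <= n (n q)^(v-1) <=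
    (n/d) d^v, and d^v is at most the number of labellings in dimension [d + k]. *)
Lemma sum_walk_weight_le (R : realFieldType) (n d k : nat) (q : R) :
  (0 < d)%N -> (0 < k)%N -> 0 <= q <= 1 -> n%:R * q <= d%:R ->
  \sum_(l : k.-tuple 'I_n) \sum_(r : k.-tuple 'I_n) walk_weight q l r <=
  n%:R / d%:R *
  \sum_(l : k.-tuple 'I_(d + k)) \sum_(r : k.-tuple 'I_(d + k)) walk_weight (1 : R) l r.
Proof.
move=> d_gt0 k_gt0 /andP[q_ge0 q_le1] nq_le; rewrite !sum_walk_weight mulr_sumr.
apply: ler_sum => p _; rewrite mulr_sumr; apply: ler_sum => p' _.
rewrite /walk_weight expr1n mulr1 mulrCA [leRHS]mulrA [leRHS]mulrC.
rewrite ler_wpM2l ?ler0n //.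
set s := map val p; set s' := map val p'; set e := size (undup (closed_walk _ _)).
have size_s : size s = k by rewrite size_map size_tuple.
have size_s' : size s' = k by rewrite size_map size_tuple.
have vle : (size (undup s) <= k)%N by rewrite -[X in (_ <= X)%N]size_s size_undup.
have vle' : (size (undup s') <= k)%N by rewrite -[X in (_ <= X)%N]size_s' size_undup.
have v_gt0 : (0 < size (undup s))%N.
  rewrite lt0n size_eq0; apply: contraTneq k_gt0 => /undup_nil s0.
  by rewrite -size_s s0.
have ve : (size (undup s) + size (undup s') <= e.+1)%N.
  by apply: size_undup_closed_walk; rewrite size_s.
move: (size (undup s)) (size (undup s')) vle vle' v_gt0 ve => [//|v] v' vle vle' _ ve.
(* There are now [v.+1] left and [v'] right vertices, so [v + v'] is the total minus one, a lower
   bound for [e]; the power of [q] grows when the exponent drops because [q <= 1]. *)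
apply: (@le_trans _ _ (n%:R ^+ v.+1 * n%:R ^+ v' * q ^+ (v + v'))).
  rewrite -!natrX; apply: ler_pM; rewrite ?exprn_ge0 ?mulr_ge0 ?ler0n //.
    by rewrite -!natrM ler_nat leq_mul ?ffact_leq_expn.
  by apply: ler_wiXn2l; rewrite ?q_ge0.
have -> : n%:R ^+ v.+1 * n%:R ^+ v' * q ^+ (v + v') = n%:R * (n%:R * q) ^+ (v + v').
  by rewrite exprMn [n%:R ^+ (v + v')]exprD exprS !mulrA.
have d_neq0 : d%:R != 0 :> R by rewrite pnatr_eq0 -lt0n.
apply: (@le_trans _ _ (n%:R * d%:R ^+ (v + v'))).
  by rewrite ler_wpM2l ?ler0n // lerXn2r // ?nnegrE ?ler0n // mulr_ge0 ?ler0n.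
rewrite -!mulrA ler_wpM2l ?ler0n // mulrC ler_pdivlMr ?ltr0n //.
rewrite -exprSr -natrX -natrM ler_nat -addSn expnD.
by apply: leq_mul; apply: expn_leq_ffact.
Qed.

(** * Expected traces as sums over walks *)

Lemma prod_count_mem (R : comPzSemiRingType) (E : finType) (s : seq E) (F : E -> R) :
  \prod_(e <- s) F e = \prod_e F e ^+ count_mem e s.
Proof.
elim: s => [|a s IHs] /=; first by rewrite big_nil big1.
rewrite big_cons IHs [RHS](bigD1 a) // [X in _ * X = _](bigD1 a) //= eqxx.
rewrite mulrA -exprS; congr (_ * _); apply: eq_bigr => e ne_ea.
by rewrite eq_sym (negbTE ne_ea).
Qed.

(** Expectations are finite sums over configurations [b] with product weights, so independence is
    the distributivity of product over sum. *)
Lemma expectation_prod (R : comPzRingType) (E V : finType) (w h : E -> V -> R)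
    (s : seq E) :
  \sum_(b : {ffun E -> V}) (\prod_e w e (b e)) * \prod_(e <- s) h e (b e) =
  \prod_e \sum_v w e v * h e v ^+ count_mem e s.
Proof.
rewrite bigA_distr_bigA /=; apply: eq_bigr => b _.
by rewrite (prod_count_mem s) -big_split.
Qed.

Definition sample_mx (R : Type) (V : Type) (n : nat) (h : 'I_n * 'I_n -> V -> R)
    (b : 'I_n * 'I_n -> V) : 'M[R]_n := \matrix_(x, y) h (x, y) (b (x, y)).

Lemma expectation_trace (R : comPzRingType) (V : finType) (n k : nat)
    (w h : 'I_n * 'I_n -> V -> R) :
  \sum_(b : {ffun 'I_n * 'I_n -> V}) (\prod_e w e (b e)) *
     \tr ((sample_mx h b *m (sample_mx h b)^T) ^+ k.+1) =
  \sum_(l : k.+1.-tuple 'I_n) \sum_(r : k.+1.-tuple 'I_n)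
     \prod_e \sum_v w e v * h e v ^+ count_mem e (closed_walk l r).
Proof.
under eq_bigr => b _ do rewrite trace_closed_walk mulr_sumr.
rewrite exchange_big /=; apply: eq_bigr => l _.
under eq_bigr => b _ do rewrite mulr_sumr.
rewrite exchange_big /=; apply: eq_bigr => r _.
rewrite -expectation_prod; apply: eq_bigr => b _; congr (_ * _).
by apply: eq_bigr => -[x y] _; rewrite mxE.
Qed.

(** Here [m e c] stands for the moment of order c of the entry at [e]: unvisited edges give 1, an
    edge visited once gives 0, and every other edge costs one factor [q] whatever its
    multiplicity. *)
Lemma prod_moment_le (R : realFieldType) (E : finType) (q : R)
    (m : E -> nat -> R) (s : seq E) :
  0 <= q -> (forall e, m e 0 = 1) -> (forall e, m e 1 = 0) ->
  (forall e c, (1 < c)%N -> `|m e c| <= q) ->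
  \prod_e m e (count_mem e s) <= (no_single s)%:R * q ^+ size (undup s).
Proof.
move=> q_ge0 m0 m1 m2; case: (boolP (no_single s)) => [nos|]; last first.
  case/allPn => e es /negPn/eqP c1.
  by rewrite (bigD1 e) //= c1 m1 !mul0r.
rewrite mul1r (bigID (fun e => e \in s)) /= [X in _ * X]big1 ?mulr1; last first.
  by move=> e /count_memPn ->.
apply: le_trans (ler_norm _) _; rewrite normr_prod.
rewrite -(eq_bigl _ _ (mem_undup s)) -big_uniq ?undup_uniq //=.
have -> : q ^+ size (undup s) = \prod_(e <- undup s) q.
  by rewrite big_const_seq count_predT iter_mulr_1.
rewrite [leRHS]big_seq big_seq; apply: ler_prod => e; rewrite mem_undup => es.
rewrite normr_ge0 m2 //; have := allP nos _ es.
by have := es; rewrite -has_pred1 has_count; case: count => [|[]].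
Qed.

Lemma prod_moment_ge (R : realFieldType) (E : finType)
    (m : E -> nat -> R) (s : seq E) :
  (forall e, m e 0 = 1) -> (forall e, m e 1 = 0) ->
  (forall e c, (1 < c)%N -> 1 <= m e c) ->
  (no_single s)%:R <= \prod_e m e (count_mem e s).
Proof.
move=> m0 m1 m2; case: (boolP (no_single s)) => [nos|] /=; last first.
  case/allPn => e es /negPn/eqP c1.
  by rewrite (bigD1 e) //= c1 m1 !mul0r.
elim/big_ind: _ => // [x y x1 y1|e _].
  by rewrite -[leLHS]mulr1 ler_pM.
have [->|] := posnP (count_mem e s); first by rewrite m0.
rewrite -has_count has_pred1 => es; apply: m2; have := allP nos _ es.
by have := es; rewrite -has_pred1 has_count; case: count => [|[]].
Qed.

(** Sandwich: the first expected trace lies below a sum of walk weights with parameter [q], the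
    second above the sum with parameter 1, and [sum_walk_weight_le] links the two sums. *)
Lemma expectation_trace_le (R : realFieldType) (V V' : finType) (n d k : nat) (q : R)
    (w h : 'I_n * 'I_n -> V -> R)
    (w' h' : 'I_(d + k.+1) * 'I_(d + k.+1) -> V' -> R) :
  (0 < d)%N -> 0 <= q <= 1 -> n%:R * q <= d%:R ->
  (forall e, \sum_v w e v = 1) -> (forall e, \sum_v w e v * h e v = 0) ->
  (forall e c, (1 < c)%N -> `|\sum_v w e v * h e v ^+ c| <= q) ->
  (forall e, \sum_v w' e v = 1) -> (forall e, \sum_v w' e v * h' e v = 0) ->
  (forall e c, (1 < c)%N -> 1 <= \sum_v w' e v * h' e v ^+ c) ->
  \sum_(b : {ffun 'I_n * 'I_n -> V}) (\prod_e w e (b e)) *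
     \tr ((sample_mx h b *m (sample_mx h b)^T) ^+ k.+1) <=
  n%:R / d%:R *
  \sum_(b : {ffun 'I_(d + k.+1) * 'I_(d + k.+1) -> V'}) (\prod_e w' e (b e)) *
     \tr ((sample_mx h' b *m (sample_mx h' b)^T) ^+ k.+1).
Proof.
move=> d_gt0 /andP[q_ge0 q_le1] nq m0 m1 m2 m0' m1' m2'; rewrite !expectation_trace.
have expr0_sum (I : finType) (f g : I -> R) : \sum_v f v = 1 -> \sum_v f v * g v ^+ 0 = 1.
  by move=> f1; rewrite -[RHS]f1; apply: eq_bigr => v _; rewrite expr0 mulr1.
apply: (@le_trans _ _ (\sum_(l : k.+1.-tuple 'I_n) \sum_(r : k.+1.-tuple 'I_n)
    walk_weight q l r)).
  apply: ler_sum => l _; apply: ler_sum => r _.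
  apply: (prod_moment_le (m := fun e c => \sum_v w e v * h e v ^+ c)) => // e.
    by apply: (@expr0_sum _ (w e) (h e)).
apply: le_trans (sum_walk_weight_le d_gt0 (ltn0Sn k) _ nq) _; first exact/andP.
rewrite ler_wpM2l ?divr_ge0 ?ler0n //.
apply: ler_sum => l _; apply: ler_sum => r _.
rewrite /walk_weight expr1n mulr1.
apply: (prod_moment_ge (m := fun e c => \sum_v w' e v * h' e v ^+ c)) => // e.
  by apply: (@expr0_sum _ (w' e) (h' e)).
Qed.

(** * Norm bounds and traces of Gram powers *)

Definition dotr (R : pzRingType) (n : nat) (x y : 'rV[R]_n) : R := \sum_i x 0 i * y 0 i.

(** Squared norm. In a bound [sqn (x *m A) <= c * sqn x] the constant [c] therefore controls the
    square of the operator norm; this form avoids square roots over a general field. *)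
Definition sqn (R : pzRingType) (n : nat) (x : 'rV[R]_n) : R := \sum_i x 0 i ^+ 2.

Lemma dotrE (R : pzRingType) (n : nat) (x y : 'rV[R]_n) : dotr x y = (x *m y^T) 0 0.
Proof. by rewrite mxE; apply: eq_bigr => i _; rewrite mxE. Qed.

Lemma sqnE (R : pzRingType) (n : nat) (x : 'rV[R]_n) : sqn x = dotr x x.
Proof. by []. Qed.

Lemma dotr_mulmx (R : comPzRingType) (m n : nat) (x : 'rV[R]_m) (A : 'M[R]_(m, n)) y :
  dotr (x *m A) y = dotr x (y *m A^T).
Proof. by rewrite !dotrE trmx_mul trmxK mulmxA. Qed.

Lemma dotrC (R : comPzRingType) (n : nat) (x y : 'rV[R]_n) : dotr x y = dotr y x.
Proof. by apply: eq_bigr => i _; rewrite mulrC. Qed.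

Lemma dotrDl (R : pzRingType) (n : nat) (x y z : 'rV[R]_n) :
  dotr (x + y) z = dotr x z + dotr y z.
Proof. by rewrite !dotrE mulmxDl mxE. Qed.

Lemma dotrDr (R : pzRingType) (n : nat) (x y z : 'rV[R]_n) :
  dotr z (x + y) = dotr z x + dotr z y.
Proof. by rewrite !dotrE linearD mulmxDr mxE. Qed.

Lemma dotrZl (R : pzRingType) (n : nat) (a : R) (x y : 'rV[R]_n) :
  dotr (a *: x) y = a * dotr x y.
Proof. by rewrite !dotrE -scalemxAl mxE. Qed.

Lemma dotrZr (R : comPzRingType) (n : nat) (a : R) (x y : 'rV[R]_n) :
  dotr x (a *: y) = a * dotr x y.
Proof. by rewrite dotrC dotrZl dotrC. Qed.

Lemma sqnZ (R : comPzRingType) (n : nat) (a : R) (x : 'rV[R]_n) :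
  sqn (a *: x) = a ^+ 2 * sqn x.
Proof. by rewrite !sqnE dotrZl dotrZr mulrA. Qed.

Lemma sqn_ge0 (R : realDomainType) (n : nat) (x : 'rV[R]_n) : 0 <= sqn x.
Proof. by apply: sumr_ge0 => i _; apply: sqr_ge0. Qed.

Lemma sqn_eq0 (R : realDomainType) (n : nat) (x : 'rV[R]_n) : sqn x = 0 -> x = 0.
Proof.
move=> /eqP; rewrite psumr_eq0 => [/allP x0|i _]; last exact: sqr_ge0.
apply/rowP => i; rewrite mxE; apply/eqP; rewrite -sqrf_eq0.
by apply: x0; rewrite mem_index_enum.
Qed.

(* Lagrange's identity *)
Lemma sum_CauchySchwarz (R : realDomainType) (I : finType) (f g : I -> R) :
  (\sum_i f i * g i) ^+ 2 <= (\sum_i f i ^+ 2) * (\sum_i g i ^+ 2).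
Proof.
have : 0 <= \sum_i \sum_j (f i * g j - f j * g i) ^+ 2.
  by apply: sumr_ge0 => i _; apply: sumr_ge0 => j _; apply: sqr_ge0.
have -> : \sum_i \sum_j (f i * g j - f j * g i) ^+ 2 =
  (\sum_i f i ^+ 2) * (\sum_i g i ^+ 2) - (\sum_i f i * g i) ^+ 2 *+ 2
  + (\sum_i g i ^+ 2) * (\sum_i f i ^+ 2).
  rewrite expr2 !big_distrlr /= -sumrMnl -sumrB -big_split /=; apply: eq_bigr => i _.
  rewrite -sumrMnl -sumrB -big_split /=; apply: eq_bigr => j _.
  by ring.
by rewrite [X in _ + X]mulrC; lra.
Qed.

Lemma dotr_CauchySchwarz (R : realDomainType) (n : nat) (x y : 'rV[R]_n) :
  dotr x y ^+ 2 <= sqn x * sqn y.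
Proof. exact: sum_CauchySchwarz. Qed.

Lemma sqn_mulmx_frob (R : realDomainType) (m n : nat) (x : 'rV[R]_m) (A : 'M[R]_(m, n)) :
  sqn (x *m A) <= \tr (A *m A^T) * sqn x.
Proof.
rewrite mxtrace_mulC /mxtrace mulr_suml; apply: ler_sum => j _; rewrite !mxE mulrC.
apply: le_trans (sum_CauchySchwarz _ _) _.
by rewrite ler_wpM2l ?sqn_ge0 //; apply: ler_sum => i _; rewrite mxE.
Qed.

Lemma ler_of_sqr_le (R : realFieldType) (a b c : R) :
  0 <= a -> 0 <= b -> 0 <= c -> a ^+ 2 <= c * a * b -> a <= c * b.
Proof.
rewrite le_eqVlt => /orP[/eqP<-|a_gt0] b_ge0 c_ge0; first by rewrite mulr_ge0.
by rewrite expr2 -mulrA mulrCA ler_pM2l.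
Qed.

(** Since |xA|^2 = <x A A^T, x>, Cauchy-Schwarz turns a bound on A A^T into its square root for A.
    This is the halving step of [sqn_le_of_trace]. *)
Lemma sqn_mulmx_sym (R : realFieldType) (m n : nat) (A : 'M[R]_(m, n)) (c : R) :
  0 <= c -> (forall x, sqn (x *m (A *m A^T)) <= c ^+ 2 * sqn x) ->
  forall x, sqn (x *m A) <= c * sqn x.
Proof.
move=> c_ge0 A2 x; rewrite -(ler_pXn2r (n := 2)) ?nnegrE ?mulr_ge0 ?sqn_ge0 //.
rewrite [sqn (x *m A)]sqnE dotr_mulmx -mulmxA.
apply: le_trans (dotr_CauchySchwarz _ _) _.
by rewrite exprMn mulrC [sqn x ^+ 2]expr2 mulrA ler_wpM2r ?sqn_ge0 ?A2.
Qed.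

Lemma sqn_mulmx_trmx (R : realFieldType) (m n : nat) (A : 'M[R]_(m, n)) (c : R) :
  0 <= c -> (forall x, sqn (x *m A) <= c * sqn x) ->
  forall x, sqn (x *m A^T) <= c * sqn x.
Proof.
move=> c_ge0 Ac x; apply: ler_of_sqr_le; rewrite ?sqn_ge0 //.
rewrite [X in X ^+ 2]sqnE dotr_mulmx trmxK dotrC.
apply: le_trans (dotr_CauchySchwarz _ _) _.
by rewrite ler_wpM2r ?sqn_ge0 //; apply: Ac.
Qed.

Lemma trmx_exp (R : comPzRingType) (n k : nat) (A : 'M[R]_n) : (A ^+ k)^T = A^T ^+ k.
Proof.
elim: k => [|k IHk]; first by rewrite !expr0 trmx1.
by rewrite exprS exprSr trmx_mul IHk.
Qed.

Lemma gram_sym (R : comPzRingType) (m n : nat) (A : 'M[R]_(m, n)) :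
  (A *m A^T)^T = A *m A^T.
Proof. by rewrite trmx_mul trmxK. Qed.

(** The trace of W^(2^(j+1)) is the squared Frobenius norm of W^(2^j) and so bounds its squared
    operator norm. Applying [sqn_mulmx_sym] to the symmetric powers of W halves the exponent [j]
    times, and once more passes from W to A. *)
Lemma sqn_le_of_trace (R : realFieldType) (n j : nat) (A : 'M[R]_n) (c : R) :
  0 <= c -> \tr ((A *m A^T) ^+ (2 ^ j.+1)) <= c ^+ (2 ^ j.+1) ->
  forall x, sqn (x *m A) <= c * sqn x.
Proof.
move=> c_ge0 tr_le; set W := A *m A^T in tr_le.
have Wk_sym k : (W ^+ k)^T = W ^+ k by rewrite trmx_exp gram_sym.
have Wj x : sqn (x *m W ^+ (2 ^ j)) <= c ^+ (2 ^ j) ^+ 2 * sqn x.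
  apply: le_trans (sqn_mulmx_frob _ _) _; rewrite ler_wpM2r ?sqn_ge0 //.
  by rewrite Wk_sym mulmxE -exprD addnn -mul2n -expnS -exprM -expnSr.
suff Wi i x : (i <= j)%N -> sqn (x *m W ^+ (2 ^ (j - i))) <= c ^+ (2 ^ (j - i)) ^+ 2 * sqn x.
  by apply: sqn_mulmx_sym => // x; have := Wi j x (leqnn _); rewrite subnn !expr1.
elim: i x => [|i IHi] x ij; first by rewrite subn0.
apply: sqn_mulmx_sym => [|y]; first by rewrite !exprn_ge0.
have := IHi y (ltnW ij); have -> : (j - i = (j - i.+1).+1)%N by rewrite subnSK.
rewrite expnSr Wk_sym mulmxE -exprD addnn muln2.
by rewrite -muln2 [c ^+ (_ * 2)]exprM.
Qed.

(** With an even exponent the trace is the sum over i of |e_i W^l|^2, and each of the n terms obeys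
    the norm bound. *)
Lemma trace_gram_le (R : realFieldType) (n l : nat) (A : 'M[R]_n) (c : R) :
  0 <= c -> (forall x, sqn (x *m A) <= c * sqn x) ->
  \tr ((A *m A^T) ^+ (l + l)) <= n%:R * c ^+ (l + l).
Proof.
move=> c_ge0 Ac; set W := A *m A^T.
have W1 x : sqn (x *m W) <= c ^+ 2 * sqn x.
  rewrite mulmxA; apply: le_trans (sqn_mulmx_trmx c_ge0 Ac _) _.
  by rewrite expr2 -mulrA ler_wpM2l.
have Wl x : sqn (x *m W ^+ l) <= c ^+ (l + l) * sqn x.
  elim: l x => [|l IHl] x; first by rewrite !expr0 mulmx1 mul1r.
  rewrite exprSr -mulmxE mulmxA; apply: le_trans (W1 _) _.
  have -> : c ^+ (l.+1 + l.+1) = c ^+ 2 * c ^+ (l + l).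
    by rewrite -exprD addSn addnS.
  by rewrite -mulrA ler_wpM2l ?exprn_ge0.
have -> : W ^+ (l + l) = W ^+ l *m (W ^+ l)^T by rewrite trmx_exp gram_sym exprD.
have -> : n%:R * c ^+ (l + l) = \sum_(i < n) c ^+ (l + l).
  by rewrite sumr_const card_ord mulr_natl.
apply: ler_sum => i _; have := Wl (delta_mx 0 i).
have -> : sqn (delta_mx 0 i : 'rV[R]_n) = 1.
  rewrite /sqn (bigD1 i) //= big1 => [|j ne_ji]; rewrite !mxE !eqxx ?addr0 ?expr1n //.
  by rewrite (negbTE ne_ji) expr0n.
rewrite mulr1 -rowE; apply: le_trans; rewrite mxE /sqn.
by apply: ler_sum => j _; rewrite !mxE.
Qed.

(** * The dice matrix *)

(* Sign and absolute value of the coordinates of an integer vector. *)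
Definition lattice_point (r : nat) : finType := {ffun 'I_r -> bool * 'I_(16 * r).+1}.

Definition lattice_vec (R : pzRingType) (r : nat) (a : lattice_point r) : 'rV[R]_r :=
  \row_i ((-1) ^+ (a i).1 * ((a i).2 : nat)%:R).

Definition lattice_net (r : nat) : {set lattice_point r} :=
  [set a : lattice_point r | (\sum_i ((a i).2 : nat) ^ 2 <= 16 * r)%N].

Lemma sqn_lattice_vec (R : comPzRingType) (r : nat) (a : lattice_point r) :
  sqn (lattice_vec R a) = (\sum_i ((a i).2 : nat) ^ 2)%:R.
Proof.
rewrite natr_sum; apply: eq_bigr => i _.
by rewrite mxE exprMn -exprM mulnC exprM sqrrN expr1n expr1n mul1r natrX.
Qed.

Lemma sqn_lattice_net (R : realFieldType) (r : nat) (a : lattice_point r) :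
  a \in lattice_net r -> sqn (lattice_vec R a) <= 16 * r%:R.
Proof. by rewrite inE sqn_lattice_vec -natrM ler_nat. Qed.

Lemma sum_half_pow (R : realFieldType) (m : nat) :
  \sum_(c < m) (2^-1 : R) ^+ c = 2 - 2 * 2^-1 ^+ m.
Proof.
elim: m => [|m IHm]; first by rewrite big_ord0 expr0; ring.
by rewrite big_ord_recr /= IHm exprS; field.
Qed.

(* Each net vector [a] has weight [2 ^- (|a_1| + .. + |a_r|) >= 2 ^- (16 r)],
   and all weights sum to at most [4 ^ r]. *)
Lemma card_lattice_net (r : nat) : (#|lattice_net r| <= 2 ^ (18 * r))%N.
Proof.
pose wt (a : lattice_point r) : rat := \prod_i 2^-1 ^+ (a i).2.
have wt_ge0 a : 0 <= wt a by apply: prodr_ge0 => i _; rewrite exprn_ge0.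
have wt_ge a : a \in lattice_net r -> 2^-1 ^+ (16 * r) <= wt a.
  rewrite inE => a_le; rewrite /wt prodrXr ler_wiXn2l //.
  by apply: leq_trans a_le; apply: leq_sum => i _; case: (nat_of_ord _) => // c; rewrite leq_pmulr.
have sum_wt : \sum_a wt a <= 4 ^+ r.
  rewrite -(bigA_distr_bigA (fun _ (v : bool * 'I_(16 * r).+1) => 2^-1 ^+ v.2)) /=.
  rewrite prodr_const card_ord lerXn2r ?nnegrE //.
    by rewrite sumr_ge0 // => v _; rewrite exprn_ge0.
  rewrite -(pair_big xpredT xpredT (fun _ (c : 'I_(16 * r).+1) => 2^-1 ^+ c)) /=.
  rewrite big_bool /= sum_half_pow.
  have : (0 : rat) <= 2^-1 ^+ (16 * r).+1 by rewrite exprn_ge0.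
  by lra.
rewrite -(ler_nat rat) natrX.
have -> : (2 : rat) ^+ (18 * r) = 2 ^+ (16 * r) * 4 ^+ r.
  by rewrite -[4]/((2 : rat) ^+ 2) -exprM -exprD; congr (_ ^+ _); lia.
rewrite mulrC -ler_pdivrMr ?exprn_gt0 // -exprVn; apply: le_trans sum_wt.
apply: (@le_trans _ _ (\sum_(a in lattice_net r) wt a)).
  by rewrite mulr_natl -sumr_const ler_sum.
by rewrite [leRHS](bigID (fun a => a \in lattice_net r)) /= lerDl sumr_ge0.
Qed.

(** Rounding each coordinate towards zero cannot leave the ball and moves each coordinate by at most
    1. The error has length at most a quarter of the radius 4 sqrt r. *)
Lemma lattice_net_round (R : realType) (r : nat) (x : 'rV[R]_r) :
  sqn x <= 16 * r%:R ->
  exists2 a, a \in lattice_net r & sqn (x - lattice_vec R a) <= r%:R.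
Proof.
move=> x_le; pose c i := Num.truncn `|x 0 i|.
have c_le i : (c i)%:R <= `|x 0 i| by rewrite truncn_le.
have c_gt i : `|x 0 i| < (c i).+1%:R by rewrite truncnS_gt.
have c2_le i : (c i)%:R ^+ 2 <= x 0 i ^+ 2.
  by rewrite -[x 0 i ^+ 2]real_normK ?num_real // lerXn2r ?nnegrE.
have sum_c : (\sum_i c i ^ 2 <= 16 * r)%N.
  rewrite -(ler_nat R) natrM; apply: le_trans x_le; rewrite natr_sum.
  by apply: ler_sum => i _; rewrite natrX.
have c_lt i : (c i < (16 * r).+1)%N.
  rewrite ltnS; apply: leq_trans sum_c; rewrite (bigD1 i) //=.
  apply: leq_trans (leq_addr _ _).
  by case: (c i) => // k; rewrite leq_pmulr.
pose a : lattice_point r := [ffun i => (x 0 i < 0, Ordinal (c_lt i))].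
exists a; first by rewrite inE; under eq_bigr => i _ do rewrite ffunE.
rewrite -[leRHS]mulr1 -[X in X%:R * _](card_ord r) mulr_natl -sumr_const.
apply: ler_sum => i _; rewrite !mxE ffunE /=.
have [c1 c2] := (c_le i, c_gt i); rewrite -natr1 in c2.
set d := (c i)%:R in c1 c2 *; have d_ge0 : 0 <= d by rewrite ler0n.
set e := (-1) ^+ (x 0 i < 0)%R; have e2 : e ^+ 2 = 1 by rewrite sqrr_sign.
have xE : x 0 i = e * `|x 0 i| by rewrite [LHS]realEsign ?num_real.
rewrite [X in X - _]xE; set y := `|x 0 i| in c1 c2 *.
by rewrite -mulrBr exprMn e2; nra.
Qed.

(** If S is the supremum of the bilinear form over the ball of squared radius 16 r, rounding both
    arguments costs S/4 each, so S <= m + S/2. The norm is then at most 2 m / (16 r). *)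
Lemma sqn_mulmx_le_net (R : realType) (r : nat) (B : 'M[R]_r) (m : R) :
  (0 < r)%N ->
  (forall a b, a \in lattice_net r -> b \in lattice_net r ->
    dotr (lattice_vec R a *m B) (lattice_vec R b) <= m) ->
  forall x, sqn (x *m B) <= (m / (8 * r%:R)) ^+ 2 * sqn x.
Proof.
move=> r_gt0 net_le; set N : R := 16 * r%:R.
have r_gt0R : (0 : R) < r%:R by rewrite ltr0n.
have N_gt0 : 0 < N by rewrite mulr_gt0.
pose V : set R := [set v | exists x y : 'rV[R]_r,
   [/\ sqn x <= N, sqn y <= N & v = dotr (x *m B) y]]%classic.
have sqn0 : sqn (0 : 'rV[R]_r) = 0 by rewrite /sqn big1 // => i _; rewrite mxE expr0n.
have V0 : V 0.
  exists 0, 0; rewrite sqn0 ltW //; split => //.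
  by rewrite mul0mx /dotr big1 // => i _; rewrite mxE mul0r.
(* A crude Frobenius bound, needed only for the supremum to be finite; the summand 1 serves to
   deduce t <= F from t^2 <= F - 1. *)
pose F := \tr (B *m B^T) * N * N + 1.
have F_ub x y : sqn x <= N -> sqn y <= N -> dotr (x *m B) y <= F.
  move=> xN yN; have := dotr_CauchySchwarz (x *m B) y.
  have xB := sqn_mulmx_frob x B; set t := dotr _ _ => t2.
  have tr_ge0 : 0 <= \tr (B *m B^T).
    apply: sumr_ge0 => i _; rewrite mxE; apply: sumr_ge0 => j _.
    by rewrite mxE -expr2 sqr_ge0.
  have : t ^+ 2 <= \tr (B *m B^T) * N * N.
    apply: le_trans t2 _; apply: ler_pM; rewrite ?sqn_ge0 //.
    by apply: le_trans xB _; rewrite ler_wpM2l.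
  by rewrite /F; nra.
have supV : has_sup V.
  split; first by exists 0.
  by exists F => _ [x [y [xN yN ->]]]; exact: F_ub.
set S := sup V.
have S_ub x y : sqn x <= N -> sqn y <= N -> dotr (x *m B) y <= S.
  by move=> xN yN; apply: sup_upper_bound => //; exists x, y.
have small x : sqn x <= r%:R -> sqn (4 *: x) <= N.
  by move=> xr; rewrite sqnZ /N (_ : 4 ^+ 2 = 16) ?ler_wpM2l //; ring.
have S_le : S <= m + S / 2.
  apply: ge_sup; first by exists 0.
  move=> _ [x [y [xN yN ->]]].
  have [a a_net xa] := lattice_net_round xN.
  have [b b_net yb] := lattice_net_round yN.
  set u := lattice_vec R a in xa; set v := lattice_vec R b in yb.
  have e1 : dotr ((4 *: (x - u)) *m B) y <= S by apply: S_ub => //; apply: small.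
  have e2 : dotr (u *m B) (4 *: (y - v)) <= S.
    by apply: S_ub; [apply: sqn_lattice_net|apply: small].
  have e3 : dotr (u *m B) v <= m by apply: net_le.
  rewrite -scalemxAl dotrZl in e1; rewrite dotrZr in e2.
  have -> : dotr (x *m B) y =
      dotr ((x - u) *m B) y + dotr (u *m B) (y - v) + dotr (u *m B) v.
    by rewrite -addrA -dotrDr subrK -dotrDl -mulmxDl subrK.
  by move: e1 e2 e3; lra.
have S_le2m : S <= 2 * m by lra.
move=> x; set y := x *m B.
have [x0|x_neq0] := eqVneq (sqn x) 0.
  rewrite /y (sqn_eq0 x0) mul0mx sqn0 mulr_ge0 ?sqn_ge0 ?sqr_ge0 //.
have [y0|y_neq0] := eqVneq (sqn y) 0.
  by rewrite y0 mulr_ge0 ?sqn_ge0 ?sqr_ge0.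
have x_gt0 : 0 < sqn x by rewrite lt_neqAle eq_sym x_neq0 sqn_ge0.
have y_gt0 : 0 < sqn y by rewrite lt_neqAle eq_sym y_neq0 sqn_ge0.
(* Both [x] and its image [y] are rescaled to the boundary of the ball, where the form takes the
   value al * be * sqn y. *)
pose al := Num.sqrt (N / sqn x); pose be := Num.sqrt (N / sqn y).
have al2E : al ^+ 2 = N / sqn x by rewrite sqr_sqrtr // divr_ge0 // ltW.
have be2E : be ^+ 2 = N / sqn y by rewrite sqr_sqrtr // divr_ge0 // ltW.
have al_ge0 : 0 <= al by apply: sqrtr_ge0.
have be_ge0 : 0 <= be by apply: sqrtr_ge0.
have : dotr ((al *: x) *m B) (be *: y) <= S.
  by apply: S_ub; rewrite sqnZ ?al2E ?be2E divfK.
rewrite -scalemxAl dotrZl dotrZr -/y -sqnE => ab_le.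
have abm : al * (be * sqn y) <= 2 * m by apply: le_trans S_le2m.
have ab_ge0 : 0 <= al * (be * sqn y) by rewrite !mulr_ge0 // ltW.
have : (al * (be * sqn y)) ^+ 2 <= (2 * m) ^+ 2.
  by rewrite lerXn2r ?nnegrE // (le_trans ab_ge0).
have -> : (al * (be * sqn y)) ^+ 2 = N ^+ 2 * sqn y / sqn x.
  rewrite [LHS]exprMn [(be * _) ^+ 2]exprMn al2E be2E.
  by field; rewrite x_neq0 y_neq0.
rewrite ler_pdivrMr // mulrC -ler_pdivlMr ?exprn_gt0 // => /le_trans; apply.
by rewrite le_eqVlt /N; apply/orP; left; apply/eqP; field; rewrite gt_eqF.
Qed.

(** * Exponential moments of the dice matrix *)

Lemma expR_le (R : realType) (x : R) : expR x <= x + expR (2 * x ^+ 2).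
Proof.
have [x_le|x_gt] := leP x 2^-1; last first.
  have : expR x <= expR (2 * x ^+ 2) by rewrite ler_expR; nra.
  have : 2^-1 > 0 :> R by rewrite invr_gt0.
  by lra.
have e1 := expR_ge1Dx (2 * x ^+ 2).
have e2 : expR x * (1 - x) <= 1.
  rewrite -[leRHS](expR0 R) -(subrr x) expRD ler_wpM2l ?expR_ge0 //.
  exact: expR_ge1Dx.
(* For x <= 1/2, exp x <= 1 / (1 - x), and (1 + x + 2 x^2) (1 - x) = 1 + x^2 (1 - 2 x) >= 1. *)
suff : expR x <= 1 + x + 2 * x ^+ 2 by lra.
have x1 : 0 < 1 - x by lra.
rewrite -(ler_pM2r x1); apply: le_trans e2 _.
have : 0 <= x ^+ 2 * (1 - 2 * x) by rewrite mulr_ge0 ?sqr_ge0 //; lra.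
by lra.
Qed.

Lemma exprn_le_expR (R : realType) (m : nat) (y : R) :
  (0 < m)%N -> 0 <= y -> y ^+ m <= m%:R ^+ m * expR y.
Proof.
move=> m_gt0 y_ge0; have m_gt0R : (0 : R) < m%:R by rewrite ltr0n.
have -> : y = m%:R * (y / m%:R) by rewrite mulrC divfK // gt_eqF.
set z := y / m%:R; have z_ge0 : 0 <= z by rewrite divr_ge0 // ltW.
rewrite exprMn expRM_natl ler_wpM2l ?exprn_ge0 ?(ltW m_gt0R) //.
rewrite lerXn2r ?nnegrE ?expR_ge0 //.
by have := expR_ge1Dx z; lra.
Qed.

Definition die (R : pzRingType) (v : 'I_3) : R := if v == ord0 then 2 else -1.

Lemma sum_die (R : comPzRingType) (f : R -> R) (c : R) :
  \sum_(v < 3) c * f (die R v) = c * (f 2 + 2 * f (-1)).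
Proof. by rewrite !big_ord_recl big_ord0 /die /=; ring. Qed.

Lemma die_moment (R : realFieldType) (c : nat) :
  (1 < c)%N -> 1 <= \sum_(v < 3) 3^-1 * die R v ^+ c.
Proof.
move=> c_gt1; rewrite (sum_die (fun x => x ^+ c)).
have : (-1 : R) <= (-1) ^+ c by rewrite -signr_odd; case: odd => /=; lra.
case: c c_gt1 => [|[|[|c]]] // _; first by rewrite !expr2; lra.
have : (1 : R) <= 2 ^+ c by rewrite exprn_ege1 ?ler1n.
by rewrite 3!(exprS 2); lra.
Qed.

(** The linear terms of [expR_le] cancel because the die is centred; the larger value 2 produces the
    constant 2 * 2^2 = 8. *)
Lemma die_mgf (R : realType) (t : R) :
  \sum_(v < 3) 3^-1 * expR (t * die R v) <= expR (8 * t ^+ 2).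
Proof.
rewrite (sum_die (fun x => expR (t * x))).
have := expR_le (t * 2); have := expR_le (t * -1).
have -> : 2 * (t * 2) ^+ 2 = 8 * t ^+ 2 by ring.
have : expR (2 * (t * -1) ^+ 2) <= expR (8 * t ^+ 2).
  by rewrite ler_expR; have := sqr_ge0 t; rewrite exprMn sqrrN expr1n; lra.
by lra.
Qed.

Definition die_mx (R : pzRingType) (r : nat) (b : 'I_r * 'I_r -> 'I_3) : 'M[R]_r :=
  \matrix_(x, y) die R (b (x, y)).

Lemma die_mx_mgf (R : realType) (r : nat) (t : R) (x y : 'rV[R]_r) :
  \sum_(b : {ffun 'I_r * 'I_r -> 'I_3}) (\prod_(e : 'I_r * 'I_r) 3^-1) *
    expR (t * dotr (x *m die_mx R b) y) <= expR (8 * t ^+ 2 * (sqn x * sqn y)).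
Proof.
have dotE (b : 'I_r * 'I_r -> 'I_3) : t * dotr (x *m die_mx R b) y =
    \sum_e t * x 0 e.1 * y 0 e.2 * die R (b e).
  transitivity (\sum_e t * x 0 e.1 * y 0 e.2 * die R (b (e.1, e.2))); last first.
    by apply: eq_bigr => -[i j].
  rewrite mulr_sumr -(pair_big xpredT xpredT
    (fun i j => t * x 0 i * y 0 j * die R (b (i, j)))) exchange_big /=.
  apply: eq_bigr => j _; rewrite mxE mulr_suml mulr_sumr; apply: eq_bigr => i _.
  by rewrite mxE; ring.
under eq_bigr => b _ do rewrite dotE expR_sum -big_split /=.
rewrite -(bigA_distr_bigA (fun e v => 3^-1 * expR (t * x 0 e.1 * y 0 e.2 * die R v))).
apply: (@le_trans _ _ (\prod_e expR (8 * (t * x 0 e.1 * y 0 e.2) ^+ 2))).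
  apply: ler_prod => e _; rewrite die_mgf andbT.
  apply: sumr_ge0 => v _; apply: mulr_ge0; first by rewrite invr_ge0.
  exact: expR_ge0.
rewrite -expR_sum ler_expR le_eqVlt; apply/orP; left; apply/eqP.
rewrite -(pair_big xpredT xpredT (fun i j => 8 * (t * x 0 i * y 0 j) ^+ 2)) /=.
rewrite /sqn big_distrlr /= mulr_sumr; apply: eq_bigr => i _.
by rewrite mulr_sumr; apply: eq_bigr => j _; ring.
Qed.

(** The maximum m of the form over pairs of net points controls the norm, hence the trace by a power
    of m. That power is at most a multiple of exp (t m), which is dominated by the sum [Z] over all
    pairs, whose expectation is explicit. *)
Lemma expectation_trace_die (R : realType) (l : nat) (k := (l + l)%N) (r := (k + k)%N) :
  (0 < l)%N ->
  \sum_(b : {ffun 'I_r * 'I_r -> 'I_3}) (\prod_(e : 'I_r * 'I_r) 3^-1) *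
    \tr ((die_mx R b *m (die_mx R b)^T) ^+ k) <=
  r%:R * (k + k)%:R ^+ k * expR (136 * k%:R).
Proof.
move=> l_gt0; have k_gt0 : (0 < k)%N by rewrite addn_gt0 l_gt0.
have r_gt0 : (0 < r)%N by rewrite addn_gt0 k_gt0.
have rR_gt0 : (0 : R) < r%:R by rewrite ltr0n.
pose th : R := Num.sqrt r%:R.
have th2 : th ^+ 2 = r%:R by rewrite sqr_sqrtr // ltW.
have th_gt0 : 0 < th by rewrite sqrtr_gt0.
(* Chosen to make the sub-Gaussian exponent 8 t^2 (16 r)^2 equal to 32 r, of the same order as the
   logarithm of the size of the net. *)
pose t : R := th / (8 * r%:R).
(* The zero vector makes the net nonempty and the maximum nonnegative. *)
pose a0 : lattice_point r := [ffun=> (false, ord0)].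
have a0_net : a0 \in lattice_net r.
  by rewrite inE big1 // => i _; rewrite ffunE.
have a0_vec : lattice_vec R a0 = 0.
  by apply/rowP => i; rewrite !mxE ffunE /= mulr0.
pose Z (b : 'I_r * 'I_r -> 'I_3) := \sum_(a in lattice_net r) \sum_(a' in lattice_net r)
  expR (t * dotr (lattice_vec R a *m die_mx R b) (lattice_vec R a')).
have tr_le b : \tr ((die_mx R b *m (die_mx R b)^T) ^+ k) <=
    r%:R * (k + k)%:R ^+ k * Z b.
  pose f (p : lattice_point r * lattice_point r) :=
    dotr (lattice_vec R p.1 *m die_mx R b) (lattice_vec R p.2).
  pose netp := [pred p : lattice_point r * lattice_point r |
    (p.1 \in lattice_net r) && (p.2 \in lattice_net r)].
  have p0_net : netp (a0, a0) by rewrite /= a0_net.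
  case: (Order.TotalTheory.arg_maxP f p0_net) => -[a a'] /andP[/= a_net a'_net] f_max.
  set m := f (a, a') in f_max.
  have m_ge0 : 0 <= m.
    apply: le_trans (f_max _ p0_net).
    by rewrite /f /= a0_vec mul0mx /dotr big1 // => i _; rewrite mxE mul0r.
  have op x : sqn (x *m die_mx R b) <= (m / (8 * r%:R)) ^+ 2 * sqn x.
    apply: sqn_mulmx_le_net => // c c' c_net c'_net.
    by apply: (f_max (c, c')); rewrite /netp /= c_net.
  apply: le_trans (trace_gram_le l (sqr_ge0 _) op) _.
  rewrite -mulrA ler_wpM2l ?ler0n // -exprM mulnC.
  have -> : m / (8 * r%:R) = t * m / th.
    by rewrite /t; field; rewrite !gt_eqF.
  rewrite expr_div_n muln2 -addnn [th ^+ _]exprD -expr2 -exprM mulnC exprM th2.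
  rewrite ler_pdivrMr ?exprn_gt0 //.
  have tm_ge0 : 0 <= t * m by rewrite mulr_ge0 // divr_ge0 ?mulr_ge0 // ltW.
  apply: le_trans (exprn_le_expR (m := k + k) _ tm_ge0) _; first by rewrite addn_gt0 k_gt0.
  have E_le : expR (t * m) <= Z b.
    rewrite /Z (bigD1 a) //= (bigD1 a') //= -addrA.
    apply: (@le_trans _ _ (expR (t * m) + 0)); first by rewrite addr0.
    rewrite lerD2l addr_ge0 //.
      by apply: sumr_ge0 => *; apply: expR_ge0.
    by apply: sumr_ge0 => *; apply: sumr_ge0 => *; apply: expR_ge0.
  rewrite exprD -[leRHS]mulrA [Z b * _]mulrC [leRHS]mulrA.
  by rewrite ler_wpM2l ?mulr_ge0 ?exprn_ge0 ?ler0n.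
have pw_ge0 : 0 <= \prod_(e : 'I_r * 'I_r) 3^-1 :> R.
  by apply: prodr_ge0 => e _; rewrite invr_ge0 ler0n.
apply: (@le_trans _ _ (r%:R * (k + k)%:R ^+ k *
  \sum_(b : {ffun 'I_r * 'I_r -> 'I_3}) (\prod_(e : 'I_r * 'I_r) 3^-1) * Z b)).
  rewrite mulr_sumr; apply: ler_sum => b _; rewrite mulrCA.
  by rewrite ler_wpM2l.
rewrite ler_wpM2l ?mulr_ge0 ?exprn_ge0 ?ler0n //.
apply: (@le_trans _ _ (\sum_(a in lattice_net r) \sum_(a' in lattice_net r)
    expR (32 * r%:R : R))).
  under eq_bigr => b _ do rewrite mulr_sumr.
  rewrite exchange_big /=; apply: ler_sum => a a_net.
  under eq_bigr => b _ do rewrite mulr_sumr.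
  rewrite exchange_big /=; apply: ler_sum => a' a'_net.
  apply: le_trans (die_mx_mgf _ _ _) _; rewrite ler_expR.
  have h : sqn (lattice_vec R a) * sqn (lattice_vec R a') <= 16 * r%:R * (16 * r%:R).
    by apply: ler_pM; rewrite ?sqn_ge0 ?sqn_lattice_net.
  apply: le_trans (ler_wpM2l _ h) _; first by rewrite mulr_ge0 ?sqr_ge0.
  rewrite /t expr_div_n th2 le_eqVlt; apply/orP; left; apply/eqP.
  by field; rewrite gt_eqF.
rewrite !sumr_const -mulrnA -[leLHS]mulr_natr.
have e1 : (2 : R) <= expR 1 by have := expR_ge1Dx (1 : R); lra.
have card_le : (#|lattice_net r|%:R : R) <= expR (18 * r%:R).
  apply: (@le_trans _ _ ((2 ^ (18 * r))%:R)); first by rewrite ler_nat card_lattice_net.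
  rewrite natrX -natrM -[X in expR X]mulr1 expRM_natl lerXn2r ?nnegrE ?expR_ge0 //.
(* One term for the exponential moment and one for each of the two net points; r = 2 k. *)
have -> : 136 * k%:R = 32 * r%:R + (18 * r%:R + 18 * r%:R) :> R.
  by rewrite /r natrD; ring.
rewrite expRD ler_wpM2l ?expR_ge0 // expRD natrM.
by apply: ler_pM; rewrite ?ler0n.
Qed.

(** * Norm of the centered Bernoulli matrix *)

Lemma trace_gram_ge0 (R : realDomainType) (n l : nat) (A : 'M[R]_n) :
  0 <= \tr ((A *m A^T) ^+ (l + l)).
Proof.
have -> : (A *m A^T) ^+ (l + l) = (A *m A^T) ^+ l *m ((A *m A^T) ^+ l)^T.
  by rewrite trmx_exp gram_sym exprD.
apply: sumr_ge0 => i _; rewrite mxE; apply: sumr_ge0 => j _.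
by rewrite [X in _ * X]mxE -expr2 sqr_ge0.
Qed.

Definition bernoulli_weight (R : pzRingType) (E : Type) (p : E -> R) (e : E) (v : bool) : R :=
  if v then p e else 1 - p e.

Definition centered (R : pzRingType) (E : Type) (p : E -> R) (e : E) (v : bool) : R :=
  v%:R - p e.

(** A centred Bernoulli variable is bounded by 1, so its higher absolute moments are at most its
    variance p (1 - p) <= p. *)
Lemma centered_moment_le (R : realFieldType) (E : Type) (p : E -> R) (q : R) (e : E)
    (c : nat) :
  0 <= p e <= 1 -> p e <= q -> (1 < c)%N ->
  `|\sum_v bernoulli_weight p e v * centered p e v ^+ c| <= q.
Proof.
move=> /andP[p_ge0 p_le1] p_le c_gt1; apply: le_trans (ler_norm_sum _ _ _) _.
have pow_le v : `|bernoulli_weight p e v * centered p e v ^+ c| <=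
    bernoulli_weight p e v * centered p e v ^+ 2.
  have w_ge0 : 0 <= bernoulli_weight p e v by rewrite /bernoulli_weight; case: v; lra.
  rewrite normrM normrX ger0_norm // ler_wpM2l // -[leRHS]real_normK ?num_real //.
  by rewrite ler_wiXn2l // /centered ler_norml; case: v {w_ge0} => /=; apply/andP; lra.
apply: le_trans (ler_sum _ (fun v _ => pow_le v)) _.
rewrite big_bool /bernoulli_weight /centered /=; apply: le_trans p_le.
by nra.
Qed.

(** Markov's inequality for the trace of order [k]. The event enters as any boolean [bad] implying
    failure of the norm bound, because that bound quantifies over all vectors and is not itself
    boolean. *)
Lemma bernoulli_norm_tail (R : realType) (n j : nat) (p : 'I_n * 'I_n -> R) (q : R)
    (bad : pred {ffun 'I_n * 'I_n -> bool}) (k := (2 ^ j.+1)%N) :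
  (forall e, 0 <= p e <= 1) -> (forall e, p e <= q) -> 0 <= q <= 1 ->
  n%:R * q <= k%:R ->
  (forall b : {ffun 'I_n * 'I_n -> bool}, bad b -> ~ forall x : 'rV[R]_n,
     sqn (x *m sample_mx (centered p) b) <= (k + k)%:R * expR 138 * sqn x) ->
  \sum_(b : {ffun 'I_n * 'I_n -> bool} | bad b) \prod_e bernoulli_weight p e (b e)
  <= n%:R * expR (- k%:R).
Proof.
move=> p01 p_le q01 nq_le badP; set c : R := (k + k)%:R * expR 138.
have k_gt0 : (0 < k)%N by rewrite expn_gt0.
have kR_gt0 : (0 : R) < k%:R by rewrite ltr0n.
have c_gt0 : 0 < c by rewrite mulr_gt0 ?expR_gt0 // ltr0n addn_gt0 k_gt0.
pose l := (2 ^ j)%N; have kE : k = (l + l)%N by rewrite /k expnS mul2n addnn.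
have wt_ge0 (b : {ffun 'I_n * 'I_n -> bool}) :
    0 <= \prod_e bernoulli_weight p e (b e).
  apply: prodr_ge0 => e _; have := p01 e.
  by rewrite /bernoulli_weight; case: (b e) => /andP[] *; lra.
pose trb (b : {ffun 'I_n * 'I_n -> bool}) := let H := sample_mx (centered p) b in
  \tr ((H *m H^T) ^+ k).
have trb_ge0 b : 0 <= trb b by rewrite /trb kE trace_gram_ge0.
have markov : \sum_(b : {ffun 'I_n * 'I_n -> bool} | bad b)
    \prod_e bernoulli_weight p e (b e) <=
    (\sum_(b : {ffun 'I_n * 'I_n -> bool}) (\prod_e bernoulli_weight p e (b e)) * trb b) / c ^+ k.
  rewrite mulr_suml [leRHS](bigID bad) /= -[leLHS]addr0 lerD //; last first.
    by apply: sumr_ge0 => b _; rewrite divr_ge0 ?mulr_ge0 ?exprn_ge0 // ltW.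
  apply: ler_sum => b /badP nop; rewrite -mulrA ler_peMr //.
  rewrite ler_pdivlMr ?exprn_gt0 // mul1r; apply/ltW; rewrite ltNge; apply/negP => tr_le.
  by apply: nop; apply: sqn_le_of_trace tr_le; apply: ltW.
have tr_le : \sum_(b : {ffun 'I_n * 'I_n -> bool})
    (\prod_e bernoulli_weight p e (b e)) * trb b <=
    n%:R / k%:R * ((k + k)%:R * (k + k)%:R ^+ k * expR (136 * k%:R)).
  have l_gt0 : (0 < l)%N by rewrite expn_gt0.
  rewrite /trb; move: k_gt0 nq_le; rewrite {}kE {trb trb_ge0 c c_gt0 badP markov kR_gt0 wt_ge0 k}.
  case: l l_gt0 => // l _ k_gt0 nq_le.
  apply: le_trans (ler_wpM2l (divr_ge0 (ler0n R n) (ler0n R _))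
    (@expectation_trace_die R l.+1 isT)).
  (* Taking [d] equal to the trace exponent gives the small matrix the dimension 2 k of
     [expectation_trace_die]. *)
  apply: (@expectation_trace_le R _ _ n (l.+1 + l.+1) (l + l.+1) q
    (bernoulli_weight p) (centered p) (fun _ _ => 3^-1) (fun _ v => die R v)) => // e.
  - by rewrite big_bool /bernoulli_weight /=; ring.
  - by rewrite big_bool /bernoulli_weight /centered /=; ring.
  - by move=> c; apply: centered_moment_le.
  - by rewrite sumr_const card_ord -[LHS]mulr_natr mulVf // pnatr_eq0.
  - by rewrite (sum_die (fun x => x)); ring.
  - by move=> c; apply: die_moment.
apply: le_trans markov _; rewrite ler_pdivrMr ?exprn_gt0 //.
apply: le_trans tr_le _.
have ck : c ^+ k = (k + k)%:R ^+ k * expR (138 * k%:R).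
  by rewrite /c exprMn expRM_natr.
rewrite ck.
(* Of the surplus exp (2 k), one factor exp k absorbs the 2 coming from (k + k) / k and the other
   remains as the tail. *)
have -> : 138 * k%:R = 136 * k%:R + (k%:R + k%:R) :> R by ring.
rewrite !expRD natrD.
have -> : n%:R / k%:R * ((k%:R + k%:R) * (k%:R + k%:R) ^+ k * expR (136 * k%:R)) =
    n%:R * 2 * (k%:R + k%:R) ^+ k * expR (136 * k%:R) :> R.
  by field; rewrite gt_eqF.
have -> : n%:R * expR (- k%:R) * ((k%:R + k%:R) ^+ k * (expR (136 * k%:R) *
    (expR k%:R * expR k%:R))) = n%:R * expR k%:R * (k%:R + k%:R) ^+ k * expR (136 * k%:R) :> R.
  have e1 : expR (- k%:R) * expR k%:R = 1 :> R by rewrite -expRD addNr expR0.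
  by rewrite -[RHS]mul1r -[X in _ = X * _]e1; ring.
do 2!(rewrite ler_wpM2r ?expR_ge0 ?exprn_ge0 ?addr_ge0 ?ler0n //).
rewrite ler_wpM2l ?ler0n //.
have := expR_ge1Dx (k%:R : R); have : (1 : R) <= k%:R by rewrite ler1n.
by lra.
Qed.

(** * Spectrum of a rank-one matrix plus noise *)
Local Open Scope complex_scope.

Definition rnorm (R : rcfType) (n : nat) (x : 'rV[R]_n) : R := Num.sqrt (sqn x).

Lemma rnorm_ge0 (R : rcfType) (n : nat) (x : 'rV[R]_n) : 0 <= rnorm x.
Proof. exact: sqrtr_ge0. Qed.

Lemma rnorm_sqr (R : rcfType) (n : nat) (x : 'rV[R]_n) : rnorm x ^+ 2 = sqn x.
Proof. by rewrite sqr_sqrtr // sqn_ge0. Qed.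

Lemma ler_dotr (R : rcfType) (n : nat) (x y : 'rV[R]_n) : dotr x y <= rnorm x * rnorm y.
Proof.
apply: le_trans (ler_norm _) _.
rewrite -(ler_pXn2r (n := 2)) ?nnegrE ?mulr_ge0 ?rnorm_ge0 //.
by rewrite real_normK ?num_real // exprMn !rnorm_sqr dotr_CauchySchwarz.
Qed.

Lemma ler_rnormD (R : rcfType) (n : nat) (x y : 'rV[R]_n) :
  rnorm (x + y) <= rnorm x + rnorm y.
Proof.
rewrite -(ler_pXn2r (n := 2)) ?nnegrE ?addr_ge0 ?rnorm_ge0 //.
rewrite sqrrD !rnorm_sqr !sqnE dotrDl !dotrDr [dotr y x]dotrC.
by have := ler_dotr x y; lra.
Qed.

Lemma cmod_ge0 (R : realType) (z : R[i]) : 0 <= cmod z.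
Proof. by case: z => a b; apply: sqrtr_ge0. Qed.

Lemma cmod_sqr (R : realType) (z : R[i]) :
  cmod z ^+ 2 = complex.Re z ^+ 2 + complex.Im z ^+ 2.
Proof. by case: z => a b; rewrite sqr_sqrtr // addr_ge0 ?sqr_ge0. Qed.

Lemma cmodM (R : realType) (z w : R[i]) : cmod (z * w) = cmod z * cmod w.
Proof. exact: ComplexField.Normc.normcM. Qed.

Lemma cmod0 (R : realType) : cmod (0 : R[i]) = 0.
Proof. exact: ComplexField.Normc.normc0. Qed.

Lemma cmod_eq0 (R : realType) (z : R[i]) : cmod z = 0 -> z = 0.
Proof. exact: ComplexField.Normc.eq0_normc. Qed.

Lemma cmodD (R : realType) (z w : R[i]) : cmod (z + w) <= cmod z + cmod w.
Proof. exact: le_normcD. Qed.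

Lemma cmodN (R : realType) (z : R[i]) : cmod (- z) = cmod z.
Proof. exact: normcN. Qed.

Lemma cmod_real (R : realType) (x : R) : cmod x%:C = `|x|.
Proof. by rewrite /cmod /= expr0n addr0 sqrtr_sqr. Qed.

Lemma cmod_sum (R : realType) (I : finType) (f : I -> R[i]) :
  cmod (\sum_i f i) <= \sum_i cmod (f i).
Proof.
elim/big_ind2: _ => [|z a w b za wb|//]; first by rewrite cmod0.
exact: le_trans (cmodD _ _) (lerD za wb).
Qed.

Definition cmods (R : realType) (n : nat) (x : 'rV[R[i]]_n) : 'rV[R]_n := map_mx (@cmod R) x.

Definition cnorm (R : realType) (n : nat) (x : 'rV[R[i]]_n) : R := rnorm (cmods x).

Lemma cnorm_ge0 (R : realType) (n : nat) (x : 'rV[R[i]]_n) : 0 <= cnorm x.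
Proof. exact: rnorm_ge0. Qed.

Lemma cnorm_eq0 (R : realType) (n : nat) (x : 'rV[R[i]]_n) : cnorm x = 0 -> x = 0.
Proof.
move=> x0; have /sqn_eq0/rowP m0 : sqn (cmods x) = 0.
  by rewrite -rnorm_sqr -/(cnorm x) x0 expr0n.
by apply/rowP => i; have := m0 i; rewrite !mxE => /cmod_eq0.
Qed.

Lemma cnormD (R : realType) (n : nat) (x y : 'rV[R[i]]_n) :
  cnorm (x + y) <= cnorm x + cnorm y.
Proof.
apply: le_trans (ler_rnormD _ _); rewrite ler_sqrt ?sqn_ge0 //.
apply: ler_sum => i _; rewrite !mxE lerXn2r ?nnegrE ?addr_ge0 ?cmod_ge0 //.
exact: cmodD.
Qed.

Lemma cnormZ (R : realType) (n : nat) (a : R[i]) (x : 'rV[R[i]]_n) :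
  cnorm (a *: x) = cmod a * cnorm x.
Proof.
rewrite /cnorm /rnorm (_ : cmods (a *: x) = cmod a *: cmods x).
  by rewrite sqnZ sqrtrM ?sqr_ge0 // sqrtr_sqr ger0_norm // cmod_ge0.
by apply/rowP => i; rewrite !mxE cmodM.
Qed.

Lemma cmod_dotr (R : realType) (n : nat) (x y : 'rV[R[i]]_n) :
  cmod (dotr x y) <= cnorm x * cnorm y.
Proof.
apply: le_trans (ler_dotr _ _); apply: le_trans (cmod_sum _) _.
by apply: ler_sum => i _; rewrite !mxE cmodM.
Qed.

Definition row_to_complex (R : realType) (n : nat) (x : 'rV[R]_n) : 'rV[R[i]]_n :=
  map_mx (real_complex R) x.

Lemma cnorm_real (R : realType) (n : nat) (x : 'rV[R]_n) :
  cnorm (row_to_complex x) = rnorm x.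
Proof.
congr Num.sqrt; apply: eq_bigr => i _.
by rewrite !mxE cmod_real real_normK ?num_real.
Qed.

(** A real matrix acts separately on real and imaginary parts, whose squared norms add up. *)
Lemma cnorm_mulmx_real (R : realType) (n : nat) (H : 'M[R]_n) (M : R) :
  0 <= M -> (forall x, sqn (x *m H) <= M ^+ 2 * sqn x) ->
  forall x : 'rV[R[i]]_n, cnorm (x *m to_complex H) <= M * cnorm x.
Proof.
move=> M_ge0 opH x.
pose re (y : 'rV[R[i]]_n) : 'rV[R]_n := map_mx (@complex.Re R) y.
pose im (y : 'rV[R[i]]_n) : 'rV[R]_n := map_mx (@complex.Im R) y.
have cn2 y : cnorm y ^+ 2 = sqn (re y) + sqn (im y).
  rewrite rnorm_sqr /sqn -big_split; apply: eq_bigr => i _.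
  by rewrite !mxE cmod_sqr.
have reM : re (x *m to_complex H) = re x *m H.
  apply/rowP => j; rewrite !mxE raddf_sum; apply: eq_bigr => i _; rewrite !mxE.
  by case: (x 0 i) => a b /=; ring.
have imM : im (x *m to_complex H) = im x *m H.
  apply/rowP => j; rewrite !mxE raddf_sum; apply: eq_bigr => i _; rewrite !mxE.
  by case: (x 0 i) => a b /=; ring.
rewrite -(ler_pXn2r (n := 2)) ?nnegrE ?mulr_ge0 ?cnorm_ge0 //.
by rewrite exprMn !cn2 reM imM mulrDr lerD.
Qed.

Lemma normc_cmod (R : realType) (z : R[i]) : `|z| = (cmod z)%:C.
Proof. by rewrite normc_def; case: z. Qed.

Lemma cmod_conjC (R : realType) (z : R[i]) : cmod (Num.conj z) = cmod z.
Proof. by apply: (@complexI R); rewrite -!normc_cmod norm_conjC. Qed.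

(** * Location and number of the large eigenvalues *)

Lemma char_poly_conj (F : fieldType) (n : nat) (P Q A : 'M[F]_n) :
  P *m Q = 1%:M -> char_poly (P *m A *m Q) = char_poly A.
Proof.
move=> PQ; have PQ' : map_mx (@polyC F) P *m map_mx (@polyC F) Q = 1%:M.
  by rewrite -map_mxM PQ map_mx1.
rewrite /char_poly (_ : char_poly_mx (P *m A *m Q) =
    map_mx (@polyC F) P *m char_poly_mx A *m map_mx (@polyC F) Q).
  by rewrite !det_mulmx mulrAC -det_mulmx PQ' det1 mul1r.
rewrite /char_poly_mx mulmxBr mulmxBl !map_mxM; congr (_ - _).
by rewrite mul_mx_scalar -scalemxAl PQ' scalemx1.
Qed.

Lemma char_poly_horner (F : fieldType) (n : nat) (A : 'M[F]_n) (z : F) :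
  (char_poly A).[z] = \det (z%:M - A).
Proof.
rewrite -horner_evalE -det_map_mx; congr (\det _).
by apply/matrixP => i j; rewrite !mxE /= horner_evalE !hornerE hornerMn hornerX.
Qed.

(** Matrix determinant lemma, from two block triangular factorisations of one bordered matrix. *)
Lemma det_sub_rank1 (F : fieldType) (n : nat) (Q : 'M[F]_n) (u v : 'rV[F]_n) :
  Q \in unitmx ->
  \det (Q - u^T *m v) = \det Q * (1 - dotr (v *m invmx Q) u).
Proof.
move=> Q_unit; pose B := block_mx (1%:M : 'M[F]_1) v u^T Q.
have e1 : B = block_mx 1%:M 0 u^T 1%:M *m block_mx 1%:M v 0 (Q - u^T *m v).
  by rewrite mulmx_block !mul0mx !mulmx0 !mul1mx mulmx1 !addr0 addrC subrK.
have e2 : B = block_mx (1%:M - v *m invmx Q *m u^T) (v *m invmx Q) 0 1%:M *m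
    block_mx 1%:M 0 u^T Q.
  by rewrite mulmx_block !mul0mx !mul1mx !mulmx0 !mulmx1 subrK mulmxKV // !add0r.
have := congr1 determinant e1; rewrite e2 !det_mulmx !det_ublock !det_lblock !det1.
rewrite !mul1r !mulr1 => <-; rewrite mulrC; congr (_ * _).
by rewrite det_mx11 !mxE eqxx dotrE [in RHS]mxE.
Qed.

(** For a left eigenvector x and a = <x, u>, the equation reads a v + x H = z x. Pairing it with u
    bounds |z - <u, v>| |a|; solving it for a v bounds (|z| - M) |x| by |a| |v|. The product of the
    two eliminates a. *)
Lemma rank1_pert_eigenvalue (R : realType) (n : nat) (u v : 'rV[R]_n) (H : 'M[R]_n)
    (M : R) (z : R[i]) :
  0 <= M -> (forall x, sqn (x *m H) <= M ^+ 2 * sqn x) ->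
  eigenvalue (to_complex (u^T *m v + H)) z ->
  cmod (z - (dotr u v)%:C) * (cmod z - M) <= rnorm u * rnorm v * M.
Proof.
move=> M_ge0 opH /eigenvalueP[x xA x_neq0].
set U := row_to_complex u; set V := row_to_complex v.
have opC := cnorm_mulmx_real M_ge0 opH.
have UV : dotr V U = (dotr u v)%:C.
  by rewrite /dotr rmorph_sum; apply: eq_bigr => i _; rewrite !mxE rmorphM mulrC.
set a := dotr x U; set xH := x *m to_complex H.
have {}xA : a *: V + xH = z *: x.
  rewrite -xA /to_complex map_mxD map_mxM mulmxDr mulmxA; congr (_ + _).
  rewrite -mul_scalar_mx; congr (_ *m _); apply/matrixP => i j.
  by rewrite !ord1 [LHS]mxE eqxx mulr1n /a dotrE map_trmx.
have cx_gt0 : 0 < cnorm x.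
  by rewrite lt_neqAle cnorm_ge0 andbT; apply: contra x_neq0 => /eqP/esym/cnorm_eq0->.
have e1 : (z - (dotr u v)%:C) * a = dotr xH U.
  have := congr1 (fun y => dotr y U) xA; rewrite dotrDl !dotrZl UV -/a => e.
  by rewrite mulrBl -e; ring.
have e2 : cmod (z - (dotr u v)%:C) * cmod a <= M * cnorm x * rnorm u.
  rewrite -cmodM e1; apply: le_trans (cmod_dotr _ _) _.
  by rewrite cnorm_real ler_wpM2r ?rnorm_ge0 ?opC.
have e3 : (cmod z - M) * cnorm x <= cmod a * rnorm v.
  have -> : cmod a * rnorm v = cnorm (z *: x - xH).
    by rewrite -xA addrK cnormZ cnorm_real.
  have := cnormD (z *: x - xH) xH; rewrite subrK cnormZ.
  by have := opC x; rewrite -/xH; lra.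
rewrite -(ler_pM2r cx_gt0) -[leLHS]mulrA.
apply: le_trans (ler_wpM2l (cmod_ge0 _) e3) _.
rewrite mulrA; apply: le_trans (ler_wpM2r (rnorm_ge0 _) e2) _.
by rewrite le_eqVlt; apply/orP; left; apply/eqP; ring.
Qed.

(** For z >= mu - r > M, with mu = <u, v>, the determinant lemma factors the characteristic
    polynomial of the sum as that of [H], which has no root there, times a factor w with z w within
    r of z - mu. So w changes sign between mu - r and mu + r. *)
Lemma rank1_pert_real_root (R : realType) (n : nat) (u v : 'rV[R]_n) (H : 'M[R]_n)
    (M r : R) :
  0 <= M -> (forall x, sqn (x *m H) <= M ^+ 2 * sqn x) -> 0 <= r ->
  M < dotr u v - r -> rnorm u * rnorm v * M <= r * (dotr u v - r - M) ->
  exists2 z : R, dotr u v - r <= z <= dotr u v + r &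
    eigenvalue (to_complex (u^T *m v + H)) z%:C.
Proof.
move=> M_ge0 opH r_ge0 M_lt uvM; set mu := dotr u v.
have opR (x : 'rV[R]_n) : rnorm (x *m H) <= M * rnorm x.
  by rewrite -(ler_pXn2r (n := 2)) ?nnegrE ?mulr_ge0 ?rnorm_ge0 // exprMn !rnorm_sqr.
pose A := u^T *m v + H.
have Q_unit z : mu - r <= z -> (z%:M - H) \in unitmx.
  move=> z_ge; rewrite unitmxE unitfE; apply/det0P => -[x x_neq0].
  rewrite mulmxBr mul_mx_scalar => /eqP; rewrite subr_eq0 => /eqP xH.
  have := opH x; rewrite -xH sqnZ.
  have : 0 < sqn x.
    rewrite lt_neqAle sqn_ge0 andbT; apply: contra x_neq0 => /eqP/esym/sqn_eq0->//.
  rewrite /mu in z_ge; move: (sqn x) => X X_gt0; rewrite ler_pM2r //.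
  by rewrite ler_pXn2r ?nnegrE //; lra.
have detE z : mu - r <= z ->
    exists2 w, (char_poly A).[z] = (char_poly H).[z] * w &
      `|z * w - (z - mu)| <= r.
  move=> z_ge; set Q := z%:M - H; have Qu := Q_unit z z_ge.
  exists (1 - dotr (v *m invmx Q) u).
    rewrite !char_poly_horner -det_sub_rank1 //; congr (\det _).
    by rewrite /A /Q opprD addrA [RHS]addrAC.
  set y := v *m invmx Q.
  have yQ : z *: y = v + y *m H.
    have : y *m Q = v by rewrite /y mulmxKV.
    by rewrite /Q mulmxBr mul_mx_scalar => <-; rewrite subrK.
  have -> : z * (1 - dotr y u) - (z - mu) = - dotr (y *m H) u.
    by rewrite mulrBr mulr1 -dotrZl yQ dotrDl [dotr v u]dotrC -/mu; ring.
  rewrite normrN.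
  have yz : rnorm y * (z - M) <= rnorm v.
    have : v = z *: y + - (y *m H) by rewrite yQ addrK.
    have z_ge0 : 0 <= z by rewrite /mu in z_ge; lra.
    have := ler_rnormD v (y *m H); rewrite -yQ.
    have -> : rnorm (z *: y) = z * rnorm y.
      by rewrite /rnorm sqnZ sqrtrM ?sqr_ge0 // sqrtr_sqr ger0_norm.
    by have := opR y; lra.
  have dle : `|dotr (y *m H) u| <= M * rnorm y * rnorm u.
    apply: (@le_trans _ _ (rnorm (y *m H) * rnorm u)); last first.
      by rewrite ler_wpM2r ?rnorm_ge0.
    rewrite ler_norml ler_dotr andbT lerNl.
    have -> : - dotr (y *m H) u = dotr (y *m H) (-1 *: u) by rewrite dotrZr mulN1r.
    apply: le_trans (ler_dotr _ _) _.
    by rewrite /rnorm sqnZ sqrrN expr1n mul1r.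
  have zM_gt0 : 0 < z - M by rewrite /mu in z_ge; lra.
  apply: le_trans dle _; rewrite -(ler_pM2r zM_gt0).
  apply: (@le_trans _ _ (M * rnorm u * rnorm v)).
    have -> : M * rnorm y * rnorm u * (z - M) = M * rnorm u * (rnorm y * (z - M)) by ring.
    by rewrite ler_wpM2l ?mulr_ge0 ?rnorm_ge0.
  apply: (@le_trans _ _ (r * (mu - r - M))); last by rewrite ler_wpM2l //; lra.
  by apply: le_trans uvM; rewrite le_eqVlt; apply/orP; left; apply/eqP; ring.
have z1_gt0 : 0 < mu - r by rewrite /mu; lra.
have z2_gt0 : 0 < mu + r by lra.
have [w1 p1 w1_le] := detE (mu - r) (lexx _).
have [w2 p2 w2_le] : exists2 w, (char_poly A).[mu + r] = (char_poly H).[mu + r] * w &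
      `|(mu + r) * w - (mu + r - mu)| <= r by apply: detE; lra.
have w1_le0 : w1 <= 0.
  by rewrite -(pmulr_rle0 _ z1_gt0); move: w1_le; rewrite ler_norml => /andP[_]; lra.
have w2_ge0 : 0 <= w2.
  by rewrite -(pmulr_rge0 _ z2_gt0); move: w2_le; rewrite ler_norml => /andP[+ _]; lra.
have H_noroot z : mu - r <= z -> ~~ root (char_poly H) z.
  move=> z_ge; rewrite rootE char_poly_horner.
  by have := Q_unit z z_ge; rewrite unitmxE unitfE.
have ivt (p : {poly R}) : p.[mu - r] * p.[mu + r] <= 0 ->
    exists2 z, mu - r <= z <= mu + r & root p z.
  move=> p_le0; have le12 : mu - r <= mu + r by lra.
  have [pa|pa] := lerP p.[mu - r] 0.
    have [pb|pb] := lerP 0 p.[mu + r].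
      by apply: poly_ivt => //; rewrite pa.
    have [pa0|pa0] := eqVneq p.[mu - r] 0.
      by exists (mu - r); rewrite ?lexx //; apply/rootP.
    have : p.[mu - r] * p.[mu + r] > 0.
      by rewrite nmulr_rgt0 // lt_neqAle pa0.
    by rewrite ltNge p_le0.
  have pb : p.[mu + r] <= 0 by rewrite -(pmulr_rle0 _ pa).
  have [|z z_in rt] := @poly_ivt R (- p) _ _ le12.
    by rewrite !hornerN oppr_le0 oppr_ge0 (ltW pa).
  by exists z; rewrite // -rootN.
have [|z z_in rt] := ivt (char_poly A).
  rewrite p1 p2 mulrACA.
  (* Opposite signs at the endpoints would give [H] a root in the interval. *)
  have HH : 0 <= (char_poly H).[mu - r] * (char_poly H).[mu + r].
    rewrite leNgt; apply/negP => /ltW /ivt[z /andP[z_ge _] rt].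
    by have := H_noroot z z_ge; rewrite rt.
  by rewrite mulr_ge0_le0 // mulr_le0_ge0.
exists z => //; rewrite eigenvalue_root_char -map_char_poly.
by rewrite /root horner_map /= (eqP rt).
Qed.

(** Subtracting the vanishing off-diagonal product cancels a1 b1 a2 b2, leaving four terms with one
    error factor and two with two. *)
Lemma minor2_bound (R : realType) (a1 a2 b1 b2 e11 e12 e21 e22 : R[i]) (A B M : R) :
  cmod a1 <= A -> cmod a2 <= A -> cmod b1 <= B -> cmod b2 <= B ->
  cmod e11 <= M -> cmod e12 <= M -> cmod e21 <= M -> cmod e22 <= M ->
  (a1 * b2 + e12) * (a2 * b1 + e21) = 0 ->
  cmod (a1 * b1 + e11) * cmod (a2 * b2 + e22) <= 4 * (A * B) * M + 2 * M ^+ 2.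
Proof.
move=> a1A a2A b1B b2B e11M e12M e21M e22M minor0; rewrite -cmodM.
have -> : (a1 * b1 + e11) * (a2 * b2 + e22) =
  a1 * b1 * e22 + a2 * b2 * e11 + - (a1 * b2 * e21) + - (a2 * b1 * e12)
    + (e11 * e22 + - (e12 * e21)).
  by rewrite -[LHS]subr0 -minor0; ring.
have abe_le (a b e : R[i]) : cmod a <= A -> cmod b <= B -> cmod e <= M ->
    cmod (a * b * e) <= A * B * M.
  move=> aA bB eM; rewrite !cmodM.
  by rewrite !ler_pM ?mulr_ge0 ?cmod_ge0.
have ee_le (e e' : R[i]) : cmod e <= M -> cmod e' <= M -> cmod (e * e') <= M ^+ 2.
  by move=> eM eM'; rewrite cmodM expr2 ler_pM ?cmod_ge0.
have h1 := abe_le _ _ _ a1A b1B e22M; have h2 := abe_le _ _ _ a2A b2B e11M.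
have h3 := abe_le _ _ _ a1A b2B e21M; have h4 := abe_le _ _ _ a2A b1B e12M.
have h5 := ee_le _ _ e11M e22M; have h6 := ee_le _ _ e12M e21M.
move: h1 h2 h3 h4 h5 h6; rewrite -[cmod (a1 * b2 * _)]cmodN -[cmod (a2 * b1 * _)]cmodN.
rewrite -[cmod (e12 * _)]cmodN.
move: (a1 * b1 * e22) (a2 * b2 * e11) (- (a1 * b2 * e21)) (- (a2 * b1 * e12)).
move: (e11 * e22) (- (e12 * e21)) => y1 y2 x1 x2 x3 x4 h1 h2 h3 h4 h5 h6.
have := cmodD (x1 + x2 + x3 + x4) (y1 + y2); have := cmodD y1 y2.
have := cmodD (x1 + x2 + x3) x4; have := cmodD (x1 + x2) x3; have := cmodD x1 x2.
by lra.
Qed.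

(* In Schur's basis the product of two diagonal entries is a 2 x 2 minor, and
   every 2 x 2 minor of a rank-one matrix vanishes. *)
Lemma rank1_pert_two_eigenvalues (R : realType) (n : nat) (u v : 'rV[R]_n) (H : 'M[R]_n)
    (M : R) (t : n.-tuple R[i]) (i j : 'I_n) :
  0 <= M -> (forall x, sqn (x *m H) <= M ^+ 2 * sqn x) ->
  char_poly (to_complex (u^T *m v + H)) = \prod_(z <- t) ('X - z%:P) -> i != j ->
  cmod (tnth t i) * cmod (tnth t j) <= 4 * (rnorm u * rnorm v) * M + 2 * M ^+ 2.
Proof.
move=> M_ge0 opH; set A := to_complex _ => charA ne_ij.
have n_gt0 : (0 < n)%N by case: (n) i {ne_ij} => [[]|].
have [P P_unit] := Schur A n_gt0; set T := conjmx P A => T_trig.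
have PP : P *m (map_mx Num.conj P^T) = 1%:M by apply/unitarymxP.
have TE : T = P *m A *m (map_mx Num.conj P^T).
  by rewrite /T conjumx ?unitarymx_unit // invmx_unitary.
have charT : char_poly A = \prod_(z <- [tuple T k k | k < n]) ('X - z%:P).
  by rewrite -(char_poly_conj A PP) -TE char_poly_trig // big_tuple;
    apply: eq_bigr => k _; rewrite tnth_mktuple.
have /tuple_permP[p tE] : perm_eq t [tuple T k k | k < n].
  by apply: prod_XsubC_eq; rewrite -charA -charT.
have tk k : tnth t k = T (p k) (p k).
  by rewrite (_ : t = [tuple tnth [tuple T k k | k < n] (p i) | i < n]) ?tnth_mktuple //;
    apply: val_inj.
rewrite !tk; have : p i != p j by rewrite (inj_eq perm_inj).
move: (p i) (p j) => k l ne_kl {tE tk i j ne_ij}.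
set U := row_to_complex u; set V := row_to_complex v.
have opC := cnorm_mulmx_real M_ge0 opH.
pose al k := dotr (row k P) U; pose be k := dotr V (map_mx Num.conj (row k P)).
pose e k l := dotr (row k P *m to_complex H) (map_mx Num.conj (row l P)).
have cn_conj (x : 'rV[R[i]]_n) : cnorm (map_mx Num.conj x) = cnorm x.
  by congr rnorm; apply/rowP => m; rewrite !mxE cmod_conjC.
have cn_row m : cnorm (row m P) = 1.
  apply/eqP; rewrite -(@eqrXn2 _ 2) ?cnorm_ge0 // expr1n; apply/eqP.
  apply: (@complexI R); have := congr1 (fun B : 'M[R[i]]_n => B m m) PP.
  rewrite mxE [RHS]mxE eqxx mulr1n => PPm.
  rewrite rmorph1 -PPm /cnorm rnorm_sqr rmorph_sum; apply: eq_bigr => q _.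
  by rewrite !mxE rmorphXn /= -normc_cmod normCK.
have TklE k' l' : T k' l' = al k' * be l' + e k' l'.
  have row_col : T k' l' = dotr (row k' P *m A) (map_mx Num.conj (row l' P)).
    by rewrite TE mxE -row_mul; apply: eq_bigr => q _; rewrite !mxE.
  rewrite row_col /A /to_complex map_mxD map_mxM mulmxDr dotrDl mulmxA; congr (_ + _).
  rewrite (_ : row k' P *m _ = (al k')%:M) ?mul_scalar_mx ?dotrZl //.
  by apply/matrixP => a b; rewrite !ord1 [RHS]mxE eqxx mulr1n /al dotrE map_trmx.
have al_le m : cmod (al m) <= rnorm u.
  by apply: le_trans (cmod_dotr _ _) _; rewrite cn_row mul1r cnorm_real.
have be_le m : cmod (be m) <= rnorm v.
  by apply: le_trans (cmod_dotr _ _) _; rewrite cn_conj cn_row mulr1 cnorm_real.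
have e_le a b : cmod (e a b) <= M.
  apply: le_trans (cmod_dotr _ _) _; rewrite cn_conj cn_row mulr1.
  by apply: le_trans (opC _) _; rewrite cn_row mulr1.
(* [T] is triangular, so one of the two entries off the diagonal is zero. *)
have minor0 : T k l * T l k = 0.
  have trig := is_trig_mxP T_trig.
  by case: (ltngtP k l) => [/trig->|/trig->|/val_inj/eqP]; rewrite ?mul0r ?mulr0 // (negbTE ne_kl).
clearbody al be e; rewrite !TklE; rewrite !TklE in minor0.
exact: minor2_bound minor0.
Qed.

(** The scales are S^2 for the rank-one part and S for the noise, and [K] solves (K - c2) c0 = 4 c1
    c2. The localisation inequality is used twice: |z| > K S first gives |z - mu| <= c0 S^2 / 4,
    hence |z| of order S^2; put back, this improves the distance to K S. *)
Lemma rank1_pert_spectrum (R : realType) (n : nat) (u v : 'rV[R]_n) (H : 'M[R]_n)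
    (t : n.-tuple R[i]) (S c0 c1 c2 : R) (K := c2 + 4 * c1 * c2 / c0) :
  0 < c0 -> 0 < c1 -> 0 < c2 -> 0 < S ->
  c0 * S ^+ 2 <= dotr u v -> rnorm u * rnorm v <= c1 * S ^+ 2 ->
  (forall x, sqn (x *m H) <= (c2 * S) ^+ 2 * sqn x) ->
  ordered_spectrum (to_complex (u^T *m v + H)) t ->
  4 * K < c0 * S -> 16 * c1 * c2 + 8 * c2 ^+ 2 < c0 ^+ 2 * S -> 1 <= S ->
  cmod (nth 0 t 0 - (dotr u v)%:C) <= K * S /\
  forall j, (0 < j)%N -> cmod (nth 0 t j) <= K * S.
Proof.
move=> c0_gt0 c1_gt0 c2_gt0 S_gt0 mu_ge uv_le opH [charA t_sorted] KS c_lt S_ge1.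
have cc_gt0 : 0 < 4 * c1 * c2 / c0 by rewrite divr_gt0 // !mulr_gt0.
have c2K : c2 < K by rewrite /K; lra.
have K_gt0 : 0 < K by lra.
have KcE : (K - c2) * c0 = 4 * c1 * c2 by rewrite /K; field; rewrite gt_eqF.
set mu := dotr u v in mu_ge *; set A := to_complex _ in charA.
have M_ge0 : 0 <= c2 * S by rewrite mulr_ge0 // ltW.
have uvM_le : rnorm u * rnorm v * (c2 * S) <= c1 * S ^+ 2 * (c2 * S).
  by rewrite ler_wpM2r.
have KS_mu : 4 * (K * S) < c0 * S ^+ 2.
  by rewrite mulrA expr2 mulrA ltr_pM2r.
have c2S : c2 * S < K * S by rewrite ltr_pM2r.
have S2_gt0 : 0 < S ^+ 2 by rewrite exprn_gt0.
have eig_le z : eigenvalue A z -> K * S < cmod z ->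
    cmod (z - mu%:C) <= K * S /\ c0 * S ^+ 2 / 2 <= cmod z.
  move=> /(rank1_pert_eigenvalue M_ge0 opH); rewrite -/mu => loc z_gt.
  have tri : mu <= cmod (z - mu%:C) + cmod z.
    have := cmodD (mu%:C - z) z; rewrite subrK cmod_real -[mu%:C - z]opprB cmodN.
    by have := ler_norm mu; lra.
  move: (cmod_ge0 (z - mu%:C)) loc tri z_gt; set d := cmod (z - _); set m := cmod z.
  move=> d_ge0 loc tri z_gt.
  have loc' : d * (m - c2 * S) <= c1 * S ^+ 2 * (c2 * S) by apply: le_trans loc _.
  have m_ge : c0 * S ^+ 2 / 2 <= m.
    have h : d * ((K - c2) * S) <= c1 * S ^+ 2 * (c2 * S).
      by apply: le_trans loc'; rewrite ler_wpM2l //; lra.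
    have h2 : d * (4 * c1 * c2) <= c0 * (c1 * c2) * S ^+ 2.
      rewrite -KcE -(ler_pM2r S_gt0).
      have := ler_wpM2l (ltW c0_gt0) h; rewrite exprS; lra.
    have h3 : d <= c0 * S ^+ 2 / 4.
      have cp : 0 < c1 * c2 by rewrite mulr_gt0.
      rewrite -(ler_pM2r cp); lra.
    lra.
  split=> //.
  have h : d * (c0 * S ^+ 2 / 4) <= c1 * S ^+ 2 * (c2 * S).
    by apply: le_trans loc'; rewrite ler_wpM2l //; lra.
  have h2 : d * c0 <= 4 * c1 * c2 * S.
    by rewrite -(ler_pM2r S2_gt0); move: h; rewrite (exprS S 1) expr1; lra.
  rewrite -KcE in h2; rewrite -(ler_pM2r c0_gt0).
  have : 0 <= c2 * c0 * S by rewrite !mulr_ge0 // ltW.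
  by lra.
have [z z_in z_eig] : exists2 z : R, mu - K * S <= z <= mu + K * S & eigenvalue A z%:C.
  apply: (rank1_pert_real_root M_ge0 opH); rewrite -/mu.
  - by rewrite mulr_ge0 // ltW.
  - by lra.
  - apply: le_trans uvM_le _.
    apply: (@le_trans _ _ (K * S * (c0 * S ^+ 2 / 4))); last first.
      by rewrite ler_wpM2l ?mulr_ge0 ?(ltW K_gt0) ?(ltW S_gt0) //; lra.
    have -> : c1 * S ^+ 2 * (c2 * S) = (K - c2) * c0 * S ^+ 3 / 4 by rewrite KcE; field.
    have : 0 <= c2 * c0 * S ^+ 3 by rewrite !mulr_ge0 ?exprn_ge0 // ltW.
    by rewrite !exprS expr0; lra.
have t_eig i : eigenvalue A (tnth t i).
  by rewrite eigenvalue_root_char charA root_prod_XsubC mem_tnth.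
have /tnthP[iz zE] : z%:C \in (t : seq _).
  by move: z_eig; rewrite eigenvalue_root_char charA root_prod_XsubC.
have n_gt0 : (0 < n)%N by case: (n) iz {zE} => [[]|].
pose i0 := Ordinal n_gt0.
have z_gt : K * S < cmod z%:C.
  by rewrite cmod_real; have := ler_norm z; move: z_in => /andP[]; lra.
have t0_gt : K * S < cmod (tnth t i0).
  by apply: lt_le_trans z_gt _; rewrite zE; apply: t_sorted.
have [t0_mu t0_ge] := eig_le _ (t_eig i0) t0_gt.
split; first by rewrite (tnth_nth 0) in t0_mu.
move=> j j_gt0; have [j_lt|j_ge] := ltnP j n; last first.
  by rewrite nth_default ?size_tuple // cmod0 mulr_ge0 // ltW.
pose i1 := Ordinal j_lt; rewrite -[nth 0 t j]/(nth 0 t i1) -tnth_nth.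
rewrite leNgt; apply/negP => t1_gt.
have [_ t1_ge] := eig_le _ (t_eig i1) t1_gt.
have ne01 : i0 != i1 by rewrite -val_eqE /= eq_sym -lt0n.
have := rank1_pert_two_eigenvalues M_ge0 opH charA ne01.
apply/negP; rewrite -ltNge.
(* Two large eigenvalues would have product at least c0^2 S^4 / 4, while the minor bound is of order
   S^3; the hypothesis with 16 c1 c2 + 8 c2^2 separates the two. *)
apply: (@lt_le_trans _ _ (c0 * S ^+ 2 / 2 * (c0 * S ^+ 2 / 2))); last first.
  by have h0 : 0 <= c0 * S ^+ 2 / 2; rewrite ?ler_pM // divr_ge0 // mulr_ge0 // ltW.
apply: (@le_lt_trans _ _ ((4 * c1 * c2 + 2 * c2 ^+ 2) * S ^+ 3)).
  have h1 : 0 <= c2 ^+ 2 * S ^+ 2 * (S - 1).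
    by rewrite mulr_ge0 ?subr_ge0 // mulr_ge0 ?sqr_ge0.
  by move: uvM_le h1; rewrite !exprS !expr0; lra.
have S3_gt0 : 0 < S ^+ 3 by rewrite exprn_gt0.
have := c_lt; rewrite -(ltr_pM2r S3_gt0) !exprS !expr0; lra.
Qed.

(** * The Chung-Lu model *)
Local Open Scope classical_set_scope.

Lemma measurable_bool_rv (R : realType) (d : measure_display) (T : measurableType d)
    (P : probability T R) (X : {RV P >-> bool}) (v : bool) :
  measurable [set t | X t = v].
Proof.
have := @measurable_funPTI _ _ _ _ X [set v] I.
by congr measurable; apply/seteqP; split.
Qed.

Lemma bool_rv_law (R : realType) (d : measure_display) (T : measurableType d)
    (P : probability T R) (E : Type) (X : E -> {RV P >-> bool}) (p : E -> R) (e : E)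
    (v : bool) :
  P [set t | X e t = true] = (p e)%:E ->
  P [set t | X e t = v] = (bernoulli_weight p e v)%:E.
Proof.
move=> pE; case: v; rewrite /bernoulli_weight //.
have -> : [set t | X e t = false] = ~` [set t | X e t = true].
  by apply/seteqP; split=> t /=; case: (X e t).
by rewrite probability_setC ?pE //; apply: measurable_bool_rv.
Qed.

Lemma bool_rv_prob01 (R : realType) (d : measure_display) (T : measurableType d)
    (P : probability T R) (X : {RV P >-> bool}) (p : R) :
  P [set t | X t = true] = p%:E -> 0 <= p <= 1.
Proof.
move=> pE; rewrite -!lee_fin -pE measure_ge0 /=.
by apply: probability_le1; apply: measurable_bool_rv.
Qed.

(** The event is a finite union of atoms [F b], whose probabilities are products by independence;
    subadditivity suffices for the upper bound. *)
Lemma independent_bool_event_le (R : realType) (d : measure_display) (T : measurableType d)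
    (P : probability T R) (E : finType) (X : E -> {RV P >-> bool}) (p : E -> R)
    (bad : pred {ffun E -> bool}) :
  (forall e, P [set t | X e t = true] = (p e)%:E) -> mutually_independent X ->
  (P [set t | bad [ffun e => X e t]] <=
   (\sum_(b : {ffun E -> bool} | bad b) \prod_e bernoulli_weight p e (b e))%:E)%E.
Proof.
move=> pE indep; pose F (b : {ffun E -> bool}) := [set t | forall e, X e t = b e].
have FE b : F b = \big[setI/setT]_(e : E) [set t | X e t = b e].
  rewrite -bigcap_seq; apply/seteqP; split=> t /= Xt; first by move=> e _; apply: Xt.
  by move=> e; apply: Xt => /=; rewrite mem_index_enum.
have mF b : measurable (F b).
  by rewrite FE; apply: bigsetI_measurable => e _; apply: measurable_bool_rv.
have PF b : P (F b) = (\prod_e bernoulli_weight p e (b e))%:E.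
  have := indep [set: E]%SET (fun e => [set b e]) (fun _ => I).
  rewrite (_ : [set t | _] = F b); last first.
    apply/seteqP; split=> t /= Xt; last by move=> e _; apply: Xt.
    by move=> e; apply: Xt; rewrite inE.
  move=> ->; rewrite (big_morph EFin (@EFinM R) erefl).
  apply: eq_big => [e|e _]; first by rewrite inE.
  exact: bool_rv_law.
have -> : [set t | bad [ffun e => X e t]] = \big[setU/set0]_(b | bad b) F b.
  rewrite -bigcup_pred; apply/seteqP; split=> t /=.
    by move=> bad_t; exists [ffun e => X e t] => // e; rewrite ffunE.
  move=> [b bad_b Ftb]; suff -> : [ffun e => X e t] = b by [].
  by apply/ffunP => e; rewrite ffunE Ftb.
rewrite -sumEFin (eq_bigr (fun b => P (F b))) => [|b _]; last by rewrite PF.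
elim: (index_enum _) => [|b r IHr]; first by rewrite !big_nil measure0.
rewrite !big_cons; case: ifP => // _.
apply: le_trans (measureU2 _ (mF b) _) _.
  by apply: bigsetU_measurable => b' _; apply: mF.
by rewrite leeD2l.
Qed.

Lemma mean_adjacency (R : realType) (n : nat) (d : measure_display) (T : measurableType d)
    (P : probability T R) (a : 'I_n -> 'I_n -> {RV P >-> bool}) (p : 'I_n -> 'I_n -> R) :
  (forall x y, P [set t | a x y t = true] = (p x y)%:E) ->
  mean_matrix P (adjacency a) = \matrix_(x, y) p x y.
Proof.
move=> pE; apply/matrixP => x y; rewrite !mxE.
rewrite (_ : (fun t => adjacency a t x y) = \1_[set t | a x y t = true]).
  by rewrite expectation_indic ?pE //; apply: measurable_bool_rv.
apply/funext => t; rewrite mxE indicE; congr (_%:R); congr nat_of_bool.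
by apply/idP/idP => [at1|]; rewrite inE.
Qed.

(** Supplies the dyadic trace exponent at the cost of a factor 2. *)
Lemma pow2_between (R : realType) (x : R) : 1 <= x ->
  exists j, x <= (2 ^ j.+1)%:R <= 2 * x.
Proof.
move=> x_ge1; have x_ge0 : 0 <= x by lra.
have m_gt0 : (0 < Num.truncn x)%N by rewrite truncn_gt0.
exists (trunc_log 2 (Num.truncn x)); apply/andP; split.
  apply/ltW; apply: lt_le_trans (truncnS_gt x) _.
  by rewrite ler_nat trunc_log_ltn.
rewrite expnS natrM ler_pM2l //; apply: le_trans (_ : (Num.truncn x)%:R <= x).
  by rewrite ler_nat trunc_logP.
by rewrite truncn_le.
Qed.

Lemma ln_nat_large (R : realType) (B : R) : \forall n \near \oo, B <= ln n%:R.
Proof.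
have := nbhs_infty_ger (expR B); apply: filterS => n Bn.
by rewrite -[B]expRK ler_ln ?posrE ?expR_gt0 // (lt_le_trans (expR_gt0 B)).
Qed.

Lemma growth_ge_ln4 (R : realType) (s : nat -> R) : (forall n, 0 < s n) ->
  assumption_X s -> \forall n \near \oo, ln n%:R ^+ 4 <= s n.
Proof.
move=> s_gt0 [xi [xi_gt4 ln_s _]].
have /cvgr_lt/(_ 1 ltr01) := ln_s.
have := ln_nat_large (1 : R); apply: filterS2 => n ln_ge1.
rewrite ltr_pdivrMr // mul1r => /ltW; apply: le_trans.
by rewrite -powR_mulrn ?(le_trans _ ln_ge1) // ler_powR // ltW.
Qed.

Lemma sqn_le_const (R : realDomainType) (n : nat) (x : 'rV[R]_n) (C : R) :
  (forall i, 0 <= x 0 i <= C) -> sqn x <= n%:R * C ^+ 2.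
Proof.
move=> xC; apply: (@le_trans _ _ (\sum_(i < n) C ^+ 2)).
  apply: ler_sum => i _; have /andP[x_ge0 x_le] := xC i.
  by rewrite lerXn2r ?nnegrE // (le_trans x_ge0).
by rewrite sumr_const card_ord mulr_natl.
Qed.

(** [rank1_pert_spectrum] is applied to [A] and also to the mean with zero noise, which spares a
    separate computation of its spectrum; the triangle inequality through <u, v> doubles [K]. *)
Lemma deviation_le (R : realType) (n : nat) (u v : 'rV[R]_n) (A : 'M[R]_n)
    (spec : 'M[R[i]]_n -> n.-tuple R[i]) (S c0 c1 c2 : R) (K := c2 + 4 * c1 * c2 / c0)
    (lambda := fun (B : 'M[R]_n) (j : nat) => eigval (spec (to_complex B)) j) :
  (forall B, ordered_spectrum B (spec B)) ->
  0 < c0 -> 0 < c1 -> 0 < c2 -> 0 < S ->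
  c0 * S ^+ 2 <= dotr u v -> rnorm u * rnorm v <= c1 * S ^+ 2 ->
  4 * K < c0 * S -> 16 * c1 * c2 + 8 * c2 ^+ 2 < c0 ^+ 2 * S -> 1 <= S ->
  (forall x, sqn (x *m (A - u^T *m v)) <= (c2 * S) ^+ 2 * sqn x) ->
  Num.max (cmod (lambda A 1%N - lambda (u^T *m v) 1%N))
    (\big[Num.max/0]_(2 <= j < n.+1) cmod (lambda A j)) <= 2 * K * S.
Proof.
move=> spec_ordered c0_gt0 c1_gt0 c2_gt0 S_gt0 mu_ge uv_le h1 h2 h3 opA.
have opZ (x : 'rV[R]_n) : sqn (x *m (0 : 'M[R]_n)) <= (c2 * S) ^+ 2 * sqn x.
  rewrite mulmx0 [leLHS]big1 => [|i _]; last by rewrite mxE expr0n.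
  by rewrite mulr_ge0 ?sqr_ge0 ?sqn_ge0.
have specA : ordered_spectrum (to_complex (u^T *m v + (A - u^T *m v)))
    (spec (to_complex A)) by rewrite addrC subrK.
have specE : ordered_spectrum (to_complex (u^T *m v + 0))
    (spec (to_complex (u^T *m v))) by rewrite addr0.
have [A1 A2] := rank1_pert_spectrum c0_gt0 c1_gt0 c2_gt0 S_gt0 mu_ge uv_le opA
  specA h1 h2 h3.
have [B1 _] := rank1_pert_spectrum c0_gt0 c1_gt0 c2_gt0 S_gt0 mu_ge uv_le opZ
  specE h1 h2 h3.
rewrite -/K in A1 A2 B1.
have K_gt0 : 0 < K by rewrite addr_gt0 // divr_gt0 // !mulr_gt0.
have KS_gt0 : 0 < K * S by rewrite mulr_gt0.
rewrite ge_max; apply/andP; split.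
  rewrite /lambda /eigval /=; set z := nth 0 _ 0 in A1 *; set w := nth 0 _ 0 in B1 *.
  have -> : z - w = (z - (dotr u v)%:C) + - (w - (dotr u v)%:C) by ring.
  by apply: le_trans (cmodD _ _) _; rewrite cmodN; lra.
rewrite big_nat; apply: bigmax_le => [|[|[|j]] // _]; first by lra.
by rewrite /lambda /eigval /=; have := A2 j.+1 isT; lra.
Qed.

(** From c n <= W <= C n: [c0 * s] is a lower bound for <u, v>, [c1 * s] an upper bound for |u| |v|,
    and [c1 * s / n] one for each link probability. The value of [c2] comes from 2 k <= 4 (c1 + 1) s
    in the norm bound. *)
Lemma chung_lu_deviation_tail (R : realType) (n : nat) (wp wm : 'I_n -> R) (s c C : R)
    (d : measure_display) (T : measurableType d) (P : probability T R)
    (a : 'I_n -> 'I_n -> {RV P >-> bool}) (spec : 'M[R[i]]_n -> n.-tuple R[i])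
    (c0 := c ^+ 2 / C) (c1 := C ^+ 2 / c) (c2 := Num.sqrt (4 * (c1 + 1) * expR 138))
    (K := c2 + 4 * c1 * c2 / c0) (S := Num.sqrt s)
    (lambda := fun (B : 'M[R]_n) (j : nat) => eigval (spec (to_complex B)) j)
    (A := adjacency a) (EA := mean_matrix P A)
    (dev := fun t : T => Num.max (cmod (lambda (A t) 1%N - lambda EA 1%N))
      (\big[Num.max/0]_(2 <= j < n.+1) cmod (lambda (A t) j))) :
  (0 < n)%N -> 0 < c -> 0 < C ->
  (forall x, c <= wp x <= C /\ c <= wm x <= C) ->
  (forall B, ordered_spectrum B (spec B)) -> 0 < s ->
  directed_chung_lu wp wm s a ->
  4 * K < c0 * S -> 16 * c1 * c2 + 8 * c2 ^+ 2 < c0 ^+ 2 * S -> 1 <= s ->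
  c1 * s <= n%:R ->
  (P [set t | ((2 * K + 1) * S <= dev t)%R] <= (n%:R * expR (- s))%:E)%E.
Proof.
move=> n_gt0 c_gt0 C_gt0 wcC spec_ordered s_gt0 [aP indep] h1 h2 s_ge1 s_le.
have nR_gt0 : (0 : R) < n%:R by rewrite ltr0n.
have S2 : S ^+ 2 = s by rewrite sqr_sqrtr // ltW.
have S_gt0 : 0 < S by rewrite sqrtr_gt0.
have S_ge1 : 1 <= S by rewrite -(ler_pXn2r (n := 2)) ?nnegrE ?(ltW S_gt0) // expr1n S2.
set W := total_weight wp.
have W_ge : c * n%:R <= W.
  rewrite mulr_natr -[X in c *+ X](card_ord n) -sumr_const; apply: ler_sum => x _.
  by have [/andP[]] := wcC x.
have W_le : W <= C * n%:R.
  rewrite mulr_natr -[X in C *+ X](card_ord n) -sumr_const; apply: ler_sum => x _.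
  by have [/andP[]] := wcC x.
have W_gt0 : 0 < W by apply: lt_le_trans W_ge; rewrite mulr_gt0.
pose u : 'rV[R]_n := \row_x (s / W * wp x); pose v : 'rV[R]_n := \row_y wm y.
pose p (e : 'I_n * 'I_n) := link_prob wp wm s e.1 e.2.
have uvE : u^T *m v = \matrix_(x, y) link_prob wp wm s x y.
  apply/matrixP => x y; rewrite !mxE big_ord1 !mxE /link_prob -/W.
  by field; rewrite gt_eqF.
have EAE : EA = u^T *m v by rewrite uvE; apply: mean_adjacency.
have c0_gt0 : 0 < c0 by rewrite divr_gt0 // exprn_gt0.
have c1_gt0 : 0 < c1 by rewrite divr_gt0 // exprn_gt0.
have c2_gt0 : 0 < c2 by rewrite sqrtr_gt0 !mulr_gt0 ?expR_gt0 // addr_gt0.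
have sW_gt0 : 0 < s / W by rewrite divr_gt0.
have sW_le : s / W <= s / (c * n%:R).
  by rewrite ler_pM2l // lef_pV2 ?posrE // mulr_gt0.
have sW_ge : s / (C * n%:R) <= s / W.
  by rewrite ler_pM2l // lef_pV2 ?posrE // mulr_gt0.
have mu_ge : c0 * S ^+ 2 <= dotr u v.
  have -> : dotr u v = s / W * \sum_x wp x * wm x.
    by rewrite mulr_sumr; apply: eq_bigr => x _; rewrite !mxE mulrA.
  apply: (@le_trans _ _ (s / (C * n%:R) * (c ^+ 2 * n%:R))).
    by rewrite S2 /c0 le_eqVlt; apply/orP; left; apply/eqP; field; rewrite !gt_eqF.
  apply: ler_pM => //.
  - by rewrite divr_ge0 ?mulr_ge0 // ltW.
  - by rewrite mulr_ge0 ?sqr_ge0 // ltW.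
  rewrite mulr_natr -[X in _ *+ X](card_ord n) -sumr_const; apply: ler_sum => x _.
  have [/andP[p1 _] /andP[m1 _]] := wcC x.
  by rewrite expr2 ler_pM // ltW.
have uv_le : rnorm u * rnorm v <= c1 * S ^+ 2.
  have b : 0 <= s / W * C by rewrite mulr_ge0 // ltW.
  have lhs_ge0 : 0 <= rnorm u * rnorm v by rewrite mulr_ge0 ?rnorm_ge0.
  have rhs_ge0 : 0 <= c1 * S ^+ 2.
    by apply: mulr_ge0; [apply: ltW|apply: sqr_ge0].
  rewrite -(ler_pXn2r (n := 2)) ?nnegrE // exprMn !rnorm_sqr S2.
  have u_le : sqn u <= n%:R * (s / W * C) ^+ 2.
    apply: sqn_le_const => x; rewrite mxE; have [/andP[p1 p2] _] := wcC x.
    by rewrite mulr_ge0 ?(ltW sW_gt0) ?(le_trans (ltW c_gt0)) //= ler_pM2l.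
  have v_le : sqn v <= n%:R * C ^+ 2.
    apply: sqn_le_const => x; rewrite mxE; have [_ /andP[m1 m2]] := wcC x.
    by rewrite m2 (le_trans (ltW c_gt0)).
  apply: le_trans (ler_pM (sqn_ge0 _) (sqn_ge0 _) u_le v_le) _.
  apply: (@le_trans _ _ ((s / (c * n%:R)) ^+ 2 * (n%:R * C ^+ 2) ^+ 2)).
    have -> : n%:R * (s / W * C) ^+ 2 * (n%:R * C ^+ 2) =
      (s / W) ^+ 2 * (n%:R * C ^+ 2) ^+ 2 by ring.
    rewrite ler_wpM2r ?sqr_ge0 // lerXn2r ?nnegrE ?(ltW sW_gt0) //.
    by rewrite divr_ge0 ?mulr_ge0 // ltW.
  by rewrite /c1 le_eqVlt; apply/orP; left; apply/eqP; field; rewrite !gt_eqF.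
pose q := c1 * s / n%:R.
have nq : n%:R * q = c1 * s by rewrite /q mulrC divfK // gt_eqF.
have q01 : 0 <= q <= 1.
  apply/andP; split; last by rewrite ler_pdivrMr // mul1r.
  rewrite /q; apply: divr_ge0; [apply: mulr_ge0|]; exact: ltW.
have p_le e : p e <= q.
  have [/andP[p1 p2] _] := wcC e.1; have [_ /andP[m1 m2]] := wcC e.2.
  have -> : p e = s / W * (wp e.1 * wm e.2).
    by rewrite /p /link_prob -/W; field; rewrite gt_eqF.
  apply: (@le_trans _ _ (s / (c * n%:R) * (C * C))); last first.
    by rewrite /q /c1 le_eqVlt; apply/orP; left; apply/eqP; field; rewrite !gt_eqF.
  have wp0 := le_trans (ltW c_gt0) p1; have wm0 := le_trans (ltW c_gt0) m1.
  have [C_ge0 sW_ge0] := (ltW C_gt0, ltW sW_gt0).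
  by apply: ler_pM => //; [apply: mulr_ge0|apply: ler_pM].
have p01 e : 0 <= p e <= 1 by apply: bool_rv_prob01 (aP e.1 e.2).
(* The summand [c1 * s] secures n q <= k, and the summand [s] turns the tail exp (- k) into exp (-
   s). *)
have [|j /andP[k_ge k_le]] := @pow2_between R ((c1 + 1) * s).
  have : 0 <= c1 * s by rewrite mulr_ge0 // ltW.
  by lra.
set k := (2 ^ j.+1)%N in k_ge k_le.
have c1s_ge0 : 0 <= c1 * s by rewrite mulr_ge0 // ltW.
pose mx (b : 'I_n * 'I_n -> bool) : 'M[R]_n := \matrix_(x, y) (b (x, y))%:R.
pose devm (B : 'M[R]_n) := Num.max (cmod (lambda B 1%N - lambda EA 1%N))
      (\big[Num.max/0]_(2 <= j < n.+1) cmod (lambda B j)).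
pose bad (b : {ffun 'I_n * 'I_n -> bool}) := (2 * K + 1) * S <= devm (mx b).
have -> : [set t | (2 * K + 1) * S <= dev t] =
    [set t | bad [ffun e : 'I_n * 'I_n => a e.1 e.2 t]].
  apply/seteqP; split=> t /=; rewrite /bad /dev -/(devm _);
    suff -> : mx [ffun e : 'I_n * 'I_n => a e.1 e.2 t] = A t by [];
    by apply/matrixP => x y; rewrite !mxE ffunE.
apply: le_trans (independent_bool_event_le bad (p := p) _ indep) _.
  by move=> e; apply: aP.
rewrite lee_fin; apply: (@le_trans _ _ (n%:R * expR (- k%:R))); last first.
  by rewrite ler_wpM2l ?(ltW nR_gt0) // ler_expR lerN2; lra.
apply: (@bernoulli_norm_tail R n j p q bad) => // [|b].
  by rewrite nq; apply: le_trans k_ge; lra.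
rewrite /bad leNgt => /negP dev_gt op; apply: dev_gt.
(* The extra 1 in the threshold [2 * K + 1] makes the inequality strict, as the deviation event is
   closed. *)
apply: (@le_lt_trans _ _ (2 * K * S)); last by rewrite ltr_pM2r //; lra.
rewrite /devm EAE; apply: (@deviation_le R n u v (mx b) spec S c0 c1 c2) => // x.
have -> : mx b - u^T *m v = sample_mx (centered p) b.
  by rewrite uvE; apply/matrixP => y z; rewrite !mxE.
apply: le_trans (op x) _; rewrite ler_wpM2r ?sqn_ge0 //.
rewrite exprMn S2 [c2 ^+ 2]sqr_sqrtr; last first.
  by rewrite !mulr_ge0 ?expR_ge0 // addr_ge0 // ltW.
rewrite mulrAC ler_wpM2r ?expR_ge0 // natrD; lra.
Qed.

Unset Implicit Arguments.
Set Strict Implicit.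
Set Printing Implicit Defensive.

Theorem theorem2p9 (R : realType)
  (wp wm : forall n : nat, 'I_n -> R) (s : nat -> R)
  (d : nat -> measure_display) (T : forall n : nat, measurableType (d n))
  (P : forall n : nat, probability (T n) R)
  (a : forall n : nat, 'I_n -> 'I_n -> {RV (P n) >-> bool})
  (spec : forall n : nat, 'M[R[i]]_n -> n.-tuple R[i])
  (spec_ordered : forall (n : nat) (M : 'M[R[i]]_n), ordered_spectrum M (spec n M))
  (w_ge0 : forall (n : nat) (x : 'I_n), 0 <= wp n x /\ 0 <= wm n x)
  (w_balanced : forall n : nat, total_weight (wp n) = total_weight (wm n))
  (s_gt0 : forall n : nat, 0 < s n)
  (model : \forall n \near \oo, directed_chung_lu (wp n) (wm n) (s n) (a n))
  (hW : assumption_W wp wm) (hX : assumption_X s) :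
  exists K eta : R, 0 < K /\ 1 < eta /\
    \forall n \near \oo,
      let lambda (M : 'M[R]_n) (j : nat) := eigval (spec n (to_complex M)) j in
      let A := adjacency (a n) in
      let EA := mean_matrix (P n) A in
      let deviation (t : T n) : R :=
        Num.max (cmod (lambda (A t) 1%N - lambda EA 1%N))
                (\big[Num.max/0]_(2 <= j < n.+1) cmod (lambda (A t) j)) in
      (P n [set t | (K * Num.sqrt (s n) <= deviation t)%R]
        <= (expR (- (ln n%:R `^ eta)))%:E)%E.
Proof.
have [[c [C [c_gt0 cC wcC]]] _] := hW.
have C_gt0 : 0 < C by apply: lt_trans cC.
pose c0 := c ^+ 2 / C; pose c1 := C ^+ 2 / c.
pose c2 := Num.sqrt (4 * (c1 + 1) * expR 138); pose K := c2 + 4 * c1 * c2 / c0.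
have c0_gt0 : 0 < c0 by rewrite divr_gt0 // exprn_gt0.
have c1_gt0 : 0 < c1 by rewrite divr_gt0 // exprn_gt0.
have c2_gt0 : 0 < c2 by rewrite sqrtr_gt0 !mulr_gt0 ?expR_gt0 // addr_gt0.
have cc_gt0 : 0 < 4 * c1 * c2 by apply: mulr_gt0 => //; apply: mulr_gt0.
have K_gt0 : 0 < K by apply: addr_gt0 => //; apply: divr_gt0.
(* The exponent 2 works because s >= L^4 with L = ln n, so that n exp (- s) <= exp (L - L^4) <= exp
   (- L^2) once L >= 2. *)
exists (2 * K + 1), 2; split; first by lra.
split; first by lra.
(* Exceeds 2 and both lower thresholds that S = sqrt s has to pass; B <= L < L^2 <= S then settles
   all three requirements. *)
pose B := 2 + 4 * K / c0 + (16 * c1 * c2 + 8 * c2 ^+ 2) / c0 ^+ 2.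
have s_small : \forall n \near \oo, c1 * s n <= n%:R.
  have [_ [_ _ s_n]] := hX; have ic1_gt0 : 0 < c1^-1 by rewrite invr_gt0.
  have /cvgr_lt/(_ _ ic1_gt0) := s_n; have := nbhs_infty_gt 0.
  apply: filterS2 => n n_gt0; rewrite ltr_pdivrMr ?ltr0n // => /ltW.
  by rewrite mulrC ler_pdivlMr // mulrC.
have s_large := growth_ge_ln4 s_gt0 hX.
have ln_large := ln_nat_large B.
near=> n.
have n_gt0 : (0 < n)%N by near: n; apply: nbhs_infty_gt.
have model_n : directed_chung_lu (wp n) (wm n) (s n) (a n) by near: n.
have s_le : c1 * s n <= n%:R by near: n.
have ln_s : ln n%:R ^+ 4 <= s n by near: n.
have B_ln : B <= ln n%:R by near: n.
set L := ln n%:R in ln_s B_ln *; pose S := Num.sqrt (s n).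
have t1_gt0 : 0 < 4 * K / c0 by apply: divr_gt0 => //; apply: mulr_gt0.
have c2sq_gt0 : 0 < c2 ^+ 2 by apply: exprn_gt0.
have c0sq_gt0 : 0 < c0 ^+ 2 by apply: exprn_gt0.
have t2_gt0 : 0 < (16 * c1 * c2 + 8 * c2 ^+ 2) / c0 ^+ 2 by apply: divr_gt0 => //; lra.
have L_ge2 : 2 <= L by apply: le_trans B_ln; rewrite /B; lra.
have LL : 2 * L <= L ^+ 2 by rewrite expr2 ler_wpM2r //; lra.
have L_S : L ^+ 2 <= S.
  have -> : L ^+ 2 = Num.sqrt (L ^+ 4).
    by rewrite (exprM L 2 2) sqrtr_sqr ger0_norm // sqr_ge0.
  exact: ler_wsqrtr.
have B_S : B < S by lra.
have S2 : S ^+ 2 = s n by rewrite sqr_sqrtr // ltW.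
have h1 : 4 * K < c0 * S.
  rewrite [ltRHS]mulrC -ltr_pdivrMr //; apply: le_lt_trans B_S; rewrite /B; lra.
have h2 : 16 * c1 * c2 + 8 * c2 ^+ 2 < c0 ^+ 2 * S.
  rewrite [ltRHS]mulrC -ltr_pdivrMr //; apply: le_lt_trans B_S; rewrite /B; lra.
have s_ge1 : 1 <= s n by rewrite -S2 expr_ge1 //; lra.
apply: le_trans (chung_lu_deviation_tail n_gt0 c_gt0 C_gt0 (wcC n) (spec_ordered n)
  (s_gt0 n) model_n h1 h2 s_ge1 s_le) _.
rewrite lee_fin -/L (powR_mulrn 2) ?ler_expR; last by lra.
have -> : n%:R = expR L by rewrite lnK // posrE ltr0n.
rewrite -expRD ler_expR.
have : L ^+ 2 * 2 <= L ^+ 4.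
  by rewrite (exprD L 2 2) ler_wpM2l ?sqr_ge0 //; lra.
by lra.
Unshelve. all: by end_near.
Qed.
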